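(* Let $(X,\mathcal{B},T)$ be a Borel system and $\alpha=\{A_i\}_{i=1}^\infty$ a measurable partition of $X$. Let $\mathrm{def}(\alpha)$ be the ($T$-invariant, measurable) set of points $x\in X$ such that for every $i$ the limit $s(x,A_i)=\lim_{n\to\infty}\frac1n\sum_{j=0}^{n-1}1_{A_i}(T^jx)$ exists and is positive, and $\sum_{i=1}^\infty s(x,A_i)<1$. Then the restriction of $T$ to $\mathrm{def}(\alpha)$ admits a $16$-set generator.
   Context: A Borel system $(X,\mathcal{B},T)$ is a standard Borel space with a Borel automorphism $T$. For an invariant Borel set $Y\subseteq X$, a $k$-set generator of $T|_Y$ is a measurable partition $\{B_1,\dots,B_k\}$ of $Y$ (empty members allowed) such that $\{T^jB_i: j\in\mathbb{Z},1\le i\le k\}$ generates the $\sigma$-algebra $\mathcal{B}|_Y$ of Borel subsets of $Y$. *)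

(* Defs.v *)
From HB Require Import structures.
From mathcomp Require Import all_boot all_order all_algebra.
From mathcomp Require Import all_classical all_reals all_analysis.

Set Implicit Arguments.
Unset Strict Implicit.
Unset Printing Implicit Defensive.

Import Order.TTheory GRing.Theory Num.Theory.
Import numFieldNormedType.Exports.

Local Open Scope classical_set_scope.
Local Open Scope ring_scope.

(* Completeness is written out with filters because the library's
   [completeType] is not joined with [metricType]. *)
Definition complete_separable (R : realType) (M : metricType R) : Prop :=
  (forall F : set_system M, ProperFilter F -> cauchy F ->
     exists l : M, F --> l) /\
  (exists2 D : set M, countable D & dense D).

(* The Polish topology lives on a separate carrier M identified with X by a
   bijection f, so that X keeps its own [measurableType] structure. *)
Definition standard_borel (R : realType) (d : measure_display)
    (X : measurableType d) : Prop :=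
  exists (M : metricType R) (f : X -> M),
    [/\ complete_separable M, bijective f &
        forall A : set M, measurable (f @^-1` A) <-> <<s @open M >> A].

Definition borel_automorphism (d : measure_display) (X : measurableType d)
    (T : X -> X) : Prop :=
  [/\ bijective T, measurable_fun [set: X] T &
      forall A : set X, measurable A -> measurable (T @` A)].

Definition borel_system (R : realType) (d : measure_display)
    (X : measurableType d) (T : X -> X) : Prop :=
  standard_borel R X /\ borel_automorphism T.

(* Unlike the library's [partition], members may be empty. *)
Definition measurable_partition (d : measure_display) (X : measurableType d)
    (I : Type) (F : I -> set X) (Y : set X) : Prop :=
  [/\ forall i, measurable (F i), trivIset [set: I] F & \bigcup_i F i = Y].

(* T^j B for a bijection T; Negz n stands for -(n+1). *)
Definition iterz_image (X : Type) (T : X -> X) (j : int) (B : set X) : set X :=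
  match j with
  | Posz n => iter n T @` B
  | Negz n => iter n.+1 T @^-1` B
  end.

(* Meant for T-invariant measurable Y: [strace measurable Y] is then the
   sigma-algebra of Borel subsets of Y. *)
Definition set_generator (d : measure_display) (X : measurableType d)
    (T : X -> X) (Y : set X) (k : nat) (B : 'I_k -> set X) : Prop :=
  measurable_partition B Y /\
  <<s Y, [set S | exists (j : int) (i : 'I_k), S = iterz_image T j (B i)] >>
    = strace measurable Y.

Definition visit_average (R : realType) (X : Type) (T : X -> X) (A : set X)
    (x : X) (n : nat) : R :=
  n%:R^-1 * \sum_(0 <= j < n) \1_A (iter j T x).

Definition visit_frequency (R : realType) (X : Type) (T : X -> X) (x : X)
    (A : set X) : R :=
  limn (@visit_average R X T A x).

Definition deficient_set (R : realType) (X : Type) (T : X -> X)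
    (A : nat -> set X) : set X :=
  [set x | (forall i, cvgn (@visit_average R X T (A i) x) /\
                      0 < visit_frequency R T x (A i)) /\
           (\sum_(0 <= i <oo) (visit_frequency R T x (A i))%:E < 1)%E].

(* Main.v *)
Require Import Defs.
From HB Require Import structures.
From mathcomp Require Import all_boot all_order all_algebra.
From mathcomp Require Import all_classical all_reals all_analysis.
From mathcomp Require Import measurable_realfun zify lra.

(** Deficiency makes the orbits compressible, in a way that finitely many labels
    can describe. Fix nested sets [level 0], [level 1], ... such that the visits
    to [level n] have bounded gaps and are far apart, and put
    [layer n = level n \ level n.+1]. One bit per point encodes the whole
    hierarchy. Since the tails of [sum s(x, A_i)] are small, the integers i split
    into finite blocks whose frequencies decrease as fast as we like; a second
    bit, carried by the points of [layer j], marks those preceded within one gap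
    by a point of the j-th block. The points followed within one gap by a marked
    point of [layer j] form the set [captured j]: it contains the j-th block, it
    is still much rarer than [layer j], and the uncaptured points have upper
    frequency < 1. Matching parentheses along forward orbits then injects the
    first-captured-at-j points into [layer j] and the uncaptured points into the
    complement of [level k], for some invariant k; the image of this injection
    avoids [layer k]. Hence the iterates of the injection send [layer k] to
    pairwise disjoint sets, which leaves room for one more bit to store, at the
    n-th image of a point, its membership in the n-th set of a countable
    generating family. With a last bit for [layer k] this makes 16 = 2^4 cells. *)

Set Implicit Arguments.
Unset Strict Implicit.
Unset Printing Implicit Defensive.

Import Order.TTheory GRing.Theory Num.Theory.
Import numFieldNormedType.Exports.

Local Open Scope classical_set_scope.

(** * Closure of a sigma-algebra under connectives and countable quantifiers *)

Section SigmaAlgebra.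
Variables (X : Type) (G : set (set X)).
Hypothesis sG : sigma_algebra [set: X] G.

Lemma sigma_setC (A : set X) : G A -> G [set x | ~ A x].
Proof. by case: sG => _ gC _ /gC; rewrite setTD. Qed.

Lemma sigma_exists (P : nat -> X -> Prop) :
  (forall n, G [set x | P n x]) -> G [set x | exists n, P n x].
Proof.
case: sG => _ _ gU gP; have := gU _ gP; congr G.
by apply/seteqP; split => x [n] => [_|]; exists n.
Qed.

Lemma sigma_forall (P : nat -> X -> Prop) :
  (forall n, G [set x | P n x]) -> G [set x | forall n, P n x].
Proof.
move=> gP; have /sigma_setC := sigma_exists (fun n => sigma_setC (gP n)).
congr G; apply/seteqP; split => x /= h.
  by move=> n; apply: contrapT => nP; apply: h; exists n.
by move=> [n]; apply.
Qed.

Lemma sigma_cst (P : Prop) : G [set x | P].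
Proof.
case: (pselect P) => [p|np].
  rewrite (_ : [set x | P] = [set x | ~ set0 x]); last first.
    by apply/seteqP; split => x //= _ [].
  by apply: sigma_setC; case: sG.
rewrite (_ : [set x | P] = set0); first by case: sG.
by apply/seteqP; split => x //= /np.
Qed.

Lemma sigma_or (P Q : X -> Prop) : G [set x | P x] -> G [set x | Q x] ->
  G [set x | P x \/ Q x].
Proof.
move=> gP gQ.
have /sigma_exists : forall n, G [set x | if n is 0 then P x else Q x] by case.
congr G; apply/seteqP; split => x /=.
  by move=> [[|n] h]; [left; exact: h|right; exact: h].
by case=> h; [exists 0|exists 1].
Qed.

Lemma sigma_imp (P Q : X -> Prop) : G [set x | P x] -> G [set x | Q x] ->
  G [set x | P x -> Q x].
Proof.
move=> gP gQ; have := sigma_or (sigma_setC gP) gQ; congr G.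
apply/seteqP; split => x /=; first by case.
by move=> h; case: (pselect (P x)) => p; [right; exact: h|left].
Qed.

Lemma sigma_and (P Q : X -> Prop) : G [set x | P x] -> G [set x | Q x] ->
  G [set x | P x /\ Q x].
Proof.
move=> gP gQ; have := sigma_setC (sigma_imp gP (sigma_setC gQ)); congr G.
apply/seteqP; split => x /=; last by move=> [p q]; exact.
move=> h; split; apply: contrapT => n; apply: h => // p q; exact: n.
Qed.

Lemma sigma_iff (P Q : X -> Prop) : G [set x | P x] -> G [set x | Q x] ->
  G [set x | P x <-> Q x].
Proof. by move=> gP gQ; apply: sigma_and; apply: sigma_imp. Qed.

Lemma sigma_ext (P Q : X -> Prop) : (forall x, P x <-> Q x) ->
  G [set x | P x] -> G [set x | Q x].
Proof. by move=> PQ; congr G; apply/seteqP; split => x /PQ. Qed.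

Variable f : X -> X.
Hypothesis Gf : forall A, G A -> G [set x | A (f x)].

Lemma sigma_iter (A : set X) n : G A -> G [set x | A (iter n f x)].
Proof. by move=> gA; elim: n A gA => // n IH A gA; apply: IH (Gf gA). Qed.

End SigmaAlgebra.
Arguments sigma_iter {X G f} Gf {A} n _.

Ltac sigma_step sG :=
  first [ assumption
        | apply: (sigma_cst sG)
        | apply: (sigma_exists sG) => ?
        | apply: (sigma_forall sG) => ?
        | apply: (sigma_and sG) | apply: (sigma_or sG)
        | apply: (sigma_iff sG)
        | apply: (sigma_imp sG) | apply: (sigma_setC sG) ].

(** * Markers *)

Section Markers.
Variables (X : Type) (T U : X -> X).
Hypotheses (TK : cancel T U) (UK : cancel U T).

Lemma iterK n : cancel (iter n T) (iter n U).
Proof. by elim: n => // n IH x; rewrite iterSr /= TK IH. Qed.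

Lemma iterKV n : cancel (iter n U) (iter n T).
Proof. by elim: n => // n IH x; rewrite iterSr /= UK IH. Qed.

Lemma iter_eqB m n x y : (n <= m)%N -> iter m T x = iter n T y ->
  y = iter (m - n) T x.
Proof.
move=> nm; rewrite -{1}(subnKC nm) iterD => /(congr1 (iter n U)).
by rewrite !iterK.
Qed.

Definition spaced (N : nat) (E : set X) :=
  forall x j, (0 < j < N)%N -> E x -> ~ E (iter j T x).

(** Points added at the same stage are kept apart by the clause on [C l], to which both belong;
    points added at different stages by the last clause, which looks both ways along the orbit. *)
Fixpoint greedy (C : nat -> set X) (E : set X) (N k : nat) : set X :=
  if k is l.+1 then
    [set x | greedy C E N l x \/
      [/\ E x, C l x, forall j, (0 < j < N)%N -> ~ C l (iter j T x) &
          forall j, (j < N)%N -> ~ greedy C E N l (iter j T x) /\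
                                 ~ greedy C E N l (iter j U x)]]
  else set0.

Definition marker (C : nat -> set X) (E : set X) (N : nat) : set X :=
  [set x | exists k, greedy C E N k x].

Lemma greedy_mono C E N k l : (k <= l)%N -> greedy C E N k `<=` greedy C E N l.
Proof.
elim: l => [|l IH]; first by rewrite leqn0 => /eqP->.
by rewrite leq_eqVlt => /predU1P[->//|/IH h x /h]; left.
Qed.

Lemma marker_sub C E N : marker C E N `<=` E.
Proof. by move=> x [k]; elim: k => // k IH [/IH|[]]. Qed.

Lemma marker_spaced C E N : spaced N (marker C E N).
Proof.
move=> x j jN [k xk] [l yl].
have {}xk := greedy_mono (leq_maxl k l) xk.
have {}yl := greedy_mono (leq_maxr k l) yl.
elim: (maxn k l) xk yl => // {k l} m IH [xk|[_ Cx xN xm]] [yk|[_ Cy yN ym]].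
- exact: IH.
- have /ym[_] : (j < N)%N by lia.
  by rewrite iterK.
- have /xm[+ _] : (j < N)%N by lia.
  exact.
- exact: xN Cy.
Qed.

(** If no marker were this close, nothing would block [x] at stage [k], and [x] itself would be a
    marker. *)
Lemma marker_near C E N x : (0 < N)%N -> E x ->
  (exists k, C k x /\ forall j, (0 < j < N)%N -> ~ C k (iter j T x)) ->
  exists2 j, (j < N)%N & marker C E N (iter j T x) \/ marker C E N (iter j U x).
Proof.
move=> N0 Ex [k [Cx Cj]]; apply: contrapT => no.
have : marker C E N x.
  exists k.+1; right; split => // j jN; split => gj; apply: no; exists j => //.
    by left; exists k.
  by right; exists k.
by move=> mx; apply: no; exists 0 => //; left.
Qed.

Section MarkerMeasurable.
Variable G : set (set X).
Hypothesis sG : sigma_algebra [set: X] G.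
Hypothesis GT : forall A, G A -> G [set x | A (T x)].
Hypothesis GU : forall A, G A -> G [set x | A (U x)].

Lemma marker_sigma C E N : (forall k, G (C k)) -> G E -> G (marker C E N).
Proof.
move=> gC gE; apply: (sigma_exists sG) => k; elim: k => [|k IH]; first by case: sG.
apply: (sigma_or sG) => //; set P := (P in [set x | P x]).
apply: (@sigma_ext _ _ (fun x => E x /\ C k x /\
   (forall j, (0 < j < N)%N -> ~ C k (iter j T x)) /\
   forall j, (j < N)%N -> ~ greedy C E N k (iter j T x) /\
                          ~ greedy C E N k (iter j U x))).
  by move=> x; split=> [[? [? []]]|[]].
by repeat (sigma_step sG || exact: gC || exact: (sigma_iter GT) || exact: (sigma_iter GU)).
Qed.

End MarkerMeasurable.

Variable C : nat -> set X.

(* [sepbound n] is the minimal distance inside [level n], and [gapbound n] the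
   maximal waiting time for [level n]; all that matters is that
   2 * gapbound n + 2 < sepbound n.+1, that
   gapbound n + 2 * sepbound n.+1 <= gapbound n.+1, and that sepbound n >= n. *)
Fixpoint gapbound (n : nat) : nat :=
  if n is m.+1 then (7 * gapbound m + 2 * m + 12)%N else 0%N.

Definition sepbound (n : nat) : nat :=
  if n is m.+1 then (3 * gapbound m + m + 6)%N else 1%N.

Fixpoint level (n : nat) : set X :=
  if n is m.+1 then marker C (level m) (sepbound m.+1) else setT.

Definition layer (n : nat) : set X := [set x | level n x /\ ~ level n.+1 x].

Lemma level_sub m n : (m <= n)%N -> level n `<=` level m.
Proof.
elim: n => [|n IH]; first by rewrite leqn0 => /eqP->.
rewrite leq_eqVlt => /predU1P[->//|/IH h x /marker_sub]; exact: h.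
Qed.

Lemma layer_inj m n x : layer m x -> layer n x -> m = n.
Proof.
move=> [mx mx'] [nx nx']; case: (ltngtP m n) => // h; exfalso.
  by apply: mx'; apply: (level_sub h).
by apply: nx'; apply: (level_sub h).
Qed.

Lemma level_spaced n : spaced (sepbound n) (level n).
Proof.
case: n => [|n]; first (by move=> x j /= ?; lia).
exact: marker_spaced.
Qed.

Variable Y : set X.
Hypothesis YT : forall x, Y x -> Y (T x).
Hypothesis CY : forall x N, Y x ->
  exists k, C k x /\ forall j, (0 < j < N)%N -> ~ C k (iter j T x).

Lemma iterY j x : Y x -> Y (iter j T x).
Proof. by move=> Yx; elim: j => //= j; exact: YT. Qed.

Lemma level_gap n x : Y x -> exists2 j, (j <= gapbound n)%N & level n (iter j T x).
Proof.
elim: n x => [|n IH] x Yx; first by exists 0.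
(* The nearby point of the next level may lie on either side; moving [sepbound n.+1] steps first
   keeps it ahead of [x]. *)
have [i iG Ry] := IH _ (iterY (sepbound n.+1) Yx).
rewrite -iterD in Ry.
have sE : sepbound n.+1 = (3 * gapbound n + n + 6)%N by [].
have s0 : (0 < sepbound n.+1)%N by lia.
have [j jN] := marker_near s0 Ry (CY (sepbound n.+1) (iterY _ Yx)).
move=> [|]; rewrite -?iterD.
  by move=> h; exists (j + (i + sepbound n.+1))%N; first (rewrite /=; lia).
move=> h; exists (i + sepbound n.+1 - j)%N; first (rewrite /= ; lia).
rewrite (_ : iter _ T x = iter j U (iter (i + sepbound n.+1) T x)) //.
apply: (can_inj (iterK j)); rewrite iterKV -iterD.
by congr (iter _ _ _); lia.
Qed.

Definition next n x a :=
  [/\ (0 < a)%N, level n (iter a T x) &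
      forall l, (0 < l < a)%N -> ~ level n (iter l T x)].

Lemma next_ex n x : Y x -> exists2 a, (a <= (gapbound n).+1)%N & next n x a.
Proof.
move=> Yx; have [j jG] := level_gap n (YT Yx).
rewrite -iterSr => lj.
have : exists a, ((0 < a)%N && `[< level n (iter a T x) >]).
  by exists j.+1; apply/andP; split=> //; exact/asboolP.
move=> ex; case: (ex_minnP ex) => a /andP[a0 /asboolP la] amin.
exists a; first by have := amin j.+1; rewrite asboolT //; move/(_ isT); lia.
split => // l /andP[l0 lla] ll; have := amin l.
by rewrite l0 asboolT // => /(_ isT); lia.
Qed.

Lemma next_inj n x a b : next n x a -> next n x b -> a = b.
Proof.
move=> [a0 la na] [b0 lb nb]; case: (ltngtP a b) => // h; exfalso.
  by apply: (nb a) => //; rewrite a0.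
by apply: (na b) => //; rewrite b0.
Qed.

(** Otherwise the later of the two points would visit [level n] strictly between the other one and
    its first return. *)
Lemma next_prev n x y a b : level n x -> level n y -> next n x a -> next n y b ->
  iter a T x = iter b T y -> x = y.
Proof.
move=> lx ly [a0 _ na] [b0 _ nb] e; case: (ltngtP a b) => h; last first.
- by have := iter_eqB (leqnn _) (etrans e (congr1 (fun k => iter k T y) (esym h)));
    rewrite subnn.
- exfalso; have ye := iter_eqB (ltnW h) e; apply: (na (a - b)%N); first by lia.
  by rewrite -ye.
- exfalso; have xe := iter_eqB (ltnW h) (esym e); apply: (nb (b - a)%N); first by lia.
  by rewrite -xe.
Qed.

(** The bit that encodes all levels: [x] determines [n], the layers being disjoint. Going back along
    [U] leaves only integer quantifiers, which suits measurability. *)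
Definition successors : set X :=
  [set x | exists n, layer n x /\ exists a, (0 < a)%N /\ level n.+1 (iter a U x) /\
     forall l, (0 < l < a)%N -> ~ level n (iter l U x)].

Lemma successorsP x : successors x <->
  exists n y a, [/\ layer n x, level n.+1 y, next n y a & x = iter a T y].
Proof.
split => [[n [lx [a [a0 [ly na]]]]]|[n [y [a [lx ly [a0 la na] xE]]]]].
  exists n, (iter a U x), a; split; rewrite ?iterKV//; split; rewrite ?iterKV//.
    by case: lx.
  move=> l la; rewrite -{1}(subKn (_ : l <= a)%N); last by lia.
  have -> : iter (a - (a - l)) T (iter a U x) = iter (a - l) U x.
    apply: (can_inj (iterK (a - l))); rewrite iterKV -iterD.
    by rewrite (_ : (_ + _)%N = a) ?iterKV//; lia.
  by apply: na; lia.
exists n; split => //; exists a; split => //; rewrite xE iterK; split => //.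
move=> l la'; have -> : iter l U (iter a T y) = iter (a - l) T y.
  apply: (can_inj (iterK l)); rewrite iterKV -iterD.
  by congr (iter _ _ _); lia.
by apply: na; lia.
Qed.

(* A point of [level n] survives to the next level exactly when its two
   successors in [level n] carry the marks (successors, not successors). *)
Lemma levelS_decode n x : Y x ->
  level n.+1 x <->
  level n x /\ exists a b, [/\ next n x a, next n (iter a T x) b,
    successors (iter a T x) & ~ successors (iter b T (iter a T x))].
Proof.
move=> Yx; have sE : sepbound n.+1 = (3 * gapbound n + n + 6)%N by [].
(* Two consecutive waiting times for [level n] add up to less than the spacing of [level n.+1]. *)
have nolevel z c : level n.+1 z -> (0 < c <= 2 * (gapbound n).+1)%N ->
    ~ level n.+1 (iter c T z).
  by move=> lz cb; apply: (level_spaced _ lz); lia.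
split => [lx|[lx [a [b [xa yb sa sb]]]]].
  have lx' := level_sub (leqnSn n) lx; split => //.
  have [a aG xa] := next_ex n Yx.
  have [b bG yb] := next_ex n (iterY a Yx).
  have [a0 la _] := xa; have [b0 lb _] := yb.
  exists a, b; split => //.
    apply/successorsP; exists n, x, a; split => //; split => //.
    by apply: nolevel lx _; lia.
  (* The second point after [x] lies in [layer n]; a mark on it would put its predecessor
     [iter a T x] in [level n.+1], too close to [x]. *)
  move=> /successorsP[m [y [c [lm ly yc e]]]].
  have ln : layer n (iter b T (iter a T x)).
    by split => //; rewrite -iterD; apply: nolevel lx _; lia.
  have mn := layer_inj lm ln; subst m.
  have ye := next_prev la (level_sub (leqnSn n) ly) yb yc e.
  by apply: (nolevel x a lx); [lia|rewrite ye].
apply: contrapT => nx.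
have [c cG xc] := next_ex n Yx; have ? := next_inj xc xa; subst c.
have [c bG yc] := next_ex n (iterY a Yx); have ? := next_inj yc yb; subst c.
have [a0 la _] := xa; have [b0 lb _] := yb.
(* If the next point of [level n] survives, the one after it is marked, against [sb]; if not, its
   own mark forces its predecessor [x] to survive. *)
case: (pselect (level n.+1 (iter a T x))) => la'.
  apply: sb; apply/successorsP; exists n, (iter a T x), b; split => //; split => //.
  by apply: nolevel la' _; lia.
move: sa => /successorsP[m [y [c [lm ly yc' e]]]].
have mn := layer_inj lm (conj la la'); subst m.
by apply: nx; rewrite (next_prev lx (level_sub (leqnSn n) ly) xa yc' e).
Qed.

Definition layerbound n := (gapbound n + (gapbound n.+1).+1)%N.

(** A visit to [level n] soon after one to [level n.+1] comes too early to lie in [level n.+1]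
    again. *)
Lemma layer_gap n x : Y x -> exists2 j, (j <= layerbound n)%N & layer n (iter j T x).
Proof.
move=> Yx; have [i iG lx] := level_gap n.+1 Yx.
have [j jG ly] := level_gap n (YT (iterY i Yx)).
move: ly; rewrite -iterSr -iterD => ly.
exists (j.+1 + i)%N; first by rewrite /layerbound; lia.
split=> //; rewrite iterD; apply: level_spaced lx.
by rewrite /sepbound; lia.
Qed.

Section LevelSigma.
Variable G : set (set X).
Hypothesis sG : sigma_algebra [set: X] G.
Hypothesis GT : forall A, G A -> G [set x | A (T x)].

(** Induction through [levelS_decode], which looks only forward, as [G] is assumed stable under
    preimages by [T] alone. *)
Lemma level_decode : G Y -> G successors -> forall n, G [set x | Y x /\ level n x].
Proof.
move=> gY gS; elim => [|n IH].
  by apply: (@sigma_ext _ _ Y) => // x; split=> // -[].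
have gl : forall j, G [set x | Y x /\ level n (iter j T x)].
  move=> j; have := sigma_and sG gY (sigma_iter GT j IH).
  by apply: sigma_ext => x; split=> -[Yx] => [[]|l]; split=> //; split=> //; apply: iterY.
have gn : forall j a, G [set x | Y x /\ next n (iter j T x) a].
  move=> j a; apply: (@sigma_ext _ _ (fun x => Y x /\ (0 < a)%N /\
    (Y x /\ level n (iter (a + j) T x)) /\
    forall l, (0 < l < a)%N -> ~ (Y x /\ level n (iter (l + j) T x)))).
    move=> x; split=> [[Yx [a0 [[_]]]]|[Yx []]].
      rewrite iterD => ? nl; split=> //; split=> // l la ?.
      by apply: (nl l la); rewrite iterD.
    move=> ? ? nl; split=> //; split=> //; split; first by rewrite iterD.
    by move=> l la [_]; rewrite iterD; apply: nl.
  by repeat (exact: gl || sigma_step sG).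
apply: (@sigma_ext _ _ (fun x => (Y x /\ level n (iter 0 T x)) /\ exists a b,
   (Y x /\ next n (iter 0 T x) a) /\ (Y x /\ next n (iter a T x) b) /\
   successors (iter a T x) /\ ~ successors (iter (b + a) T x))).
  move=> x; split=> [[[Yx lx] [a [b [[_ ?] [[_ ?] []]]]]]|[Yx]].
    rewrite iterD => ? ?; split => //; apply/levelS_decode => //.
    by split=> //; exists a, b.
  move=> /(levelS_decode _ Yx)[? [a [b [*]]]]; split => //.
  by exists a, b; rewrite iterD.
by repeat (exact: gn || exact: gl || exact: (sigma_iter GT) || sigma_step sG).
Qed.

End LevelSigma.
End Markers.

(** * Visit counts and parenthesis matching *)

Section Counting.
Variables (X : Type) (T : X -> X).

Fixpoint visits (P : set X) (n : nat) (x : X) : nat :=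
  if n is m.+1 then (visits P m x + `[< P (iter m T x) >])%N else 0%N.

Lemma visitsS P n x :
  visits P n.+1 x = (visits P n x + `[< P (iter n T x) >])%N.
Proof. by []. Qed.

Lemma visitsD P m n x :
  visits P (m + n) x = (visits P m x + visits P n (iter m T x))%N.
Proof.
by elim: n => [|n IH]; rewrite ?addn0// addnS /= IH -addnA -iterD (addnC n m).
Qed.

Lemma visits_mono P m n x : (m <= n)%N -> (visits P m x <= visits P n x)%N.
Proof. by move=> mn; rewrite -(subnKC mn) visitsD leq_addr. Qed.

Lemma visits_sub (P Q : set X) n x : (forall i, P (iter i T x) -> Q (iter i T x)) ->
  (visits P n x <= visits Q n x)%N.
Proof.
move=> PQ; elim: n => //= n IH; apply: leq_add => //.
by case: asboolP => // /PQ q; rewrite asboolT.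
Qed.

Lemma visitsC P n x : (visits [set y | ~ P y] n x + visits P n x)%N = n.
Proof.
elim: n => //= n IH; case: (pselect (P (iter n T x))) => p.
  by rewrite (asboolT p) asboolF /=; [lia|apply].
by rewrite (asboolF p) asboolT //=; lia.
Qed.

(** Each visit to [P] is charged to a visit to [Q] at one of [D] delays; then sum over the
    delays. *)
Lemma visits_spread (P Q : set X) D n x y :
  (forall i, P (iter i T x) -> exists2 d, (d < D)%N & Q (iter (d + i) T y)) ->
  (visits P n x <= D * visits Q (n + D) y)%N.
Proof.
move=> PQ; apply: (@leq_trans (\sum_(d < D) visits Q n (iter d T y))).
  elim: n => //= n IH; rewrite big_split /=; apply: leq_add => //.
  case: asboolP => // /PQ[d dD q]; rewrite (bigD1 (Ordinal dD)) //=.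
  by rewrite -iterD (addnC n) asboolT // leq_addr.
rewrite -[X in (_ <= X * _)%N](card_ord D) -sum_nat_const; apply: leq_sum => d _.
apply: (@leq_trans (visits Q (d + n) y)); first by rewrite visitsD leq_addl.
by apply: visits_mono; have := ltn_ord d; lia.
Qed.

Lemma visits_cover (P : set X) (Q : nat -> set X) a b n x :
  (forall i, P (iter i T x) -> exists l, (a <= l < b)%N /\ Q l (iter i T x)) ->
  (visits P n x <= \sum_(a <= l < b) visits (Q l) n x)%N.
Proof.
move=> PQ; elim: n => //= n IH; rewrite big_split /=; apply: leq_add => //.
case: asboolP => // /PQ[l [lab Ql]].
rewrite (bigD1_seq l) ?mem_index_iota ?iota_uniq //=.
by rewrite asboolT // leq_addr.
Qed.

(** A block of [N] consecutive times contains at most one visit; the [N] on the right pays for the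
    incomplete block. *)
Lemma visits_spaced N (E : set X) n x : spaced T N E -> (0 < N)%N ->
  (N * visits E n x <= n + N)%N.
Proof.
move=> sE N0.
have small m z : (m <= N)%N -> (visits E m z <= 1)%N.
  elim: m => //= m IH mN; case: asboolP => h; last by rewrite addn0; apply: IH; lia.
  suff -> : visits E m z = 0%N by [].
  have : forall l, (l <= m)%N -> visits E l z = 0%N; last exact.
  elim=> //= l IHl lm; rewrite IHl; last by lia.
  case: asboolP => // el; exfalso.
  have := sE _ (m - l)%N _ el; rewrite -iterD subnK; last by lia.
  by apply => //; lia.
have blocks q z : (visits E (q * N) z <= q)%N.
  elim: q => //= q IH; rewrite mulSnr visitsD.
  by have := small N (iter (q * N) T z) (leqnn _); lia.
have nq : (n <= (n %/ N).+1 * N)%N by rewrite ltnW // ltn_ceil.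
have := leq_trans (visits_mono E x nq) (blocks _ _).
have := leq_trunc_div n N.
by nia.
Qed.

Lemma visits_syndetic M (Q : set X) q x :
  (forall i, exists2 j, (j <= M)%N & Q (iter (j + i) T x)) ->
  (q <= visits Q (q * M.+1) x)%N.
Proof.
move=> sQ; elim: q => // q IH; rewrite mulSnr visitsD.
have [j jM Qj] := sQ (q * M.+1)%N; rewrite iterD in Qj.
suff : (0 < visits Q M.+1 (iter (q * M.+1) T x))%N by lia.
apply: (@leq_trans (visits Q j.+1 (iter (q * M.+1) T x))); last exact: visits_mono.
by rewrite /= asboolT //; lia.
Qed.

Section CountingSigma.
Variable G : set (set X).
Hypothesis sG : sigma_algebra [set: X] G.
Hypothesis GT : forall A, G A -> G [set x | A (T x)].

Lemma visits_sigma P n a : G P -> G [set x | visits P n x = a].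
Proof.
move=> gP; elim: n a => [|n IH] a; first exact: (sigma_cst sG (0%N = a)).
apply: (@sigma_ext _ _ (fun x =>
   P (iter n T x) /\ (0 < a)%N /\ visits P n x = a.-1 \/
   ~ P (iter n T x) /\ visits P n x = a)).
  move=> x /=; case: asboolP => p; split=> [[[? []]|[]]|] //=; try lia.
    by move=> h; left; split=> //; lia.
  by move=> h; right; split=> //; lia.
by repeat (sigma_step sG || exact: (sigma_iter GT) || exact: IH).
Qed.

Lemma visits_sigma2 (r : nat -> nat -> Prop) P Q m n : G P -> G Q ->
  G [set x | r (visits P m x) (visits Q n x)].
Proof.
move=> gP gQ; apply: (@sigma_ext _ _ (fun x =>
   exists a b, r a b /\ visits P m x = a /\ visits Q n x = b)).
  move=> x; split=> [[a [b [? [-> ->]]]]//|h].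
  by exists (visits P m x), (visits Q n x).
by repeat (sigma_step sG || exact: visits_sigma).
Qed.

End CountingSigma.
End Counting.

Section Matching.
Variables (X : Type) (T U : X -> X).
Hypotheses (TK : cancel T U) (UK : cancel U T).

(* Reading points of [P] as opening and points of [Q] as closing parentheses
   along the forward orbit, [iter t T x] closes the parenthesis opened at [x]. *)
Definition matched (P Q : set X) (x : X) (t : nat) :=
  (visits T P t.+1 x <= visits T Q t.+1 x)%N /\
  forall s, (s < t)%N -> (visits T Q s.+1 x < visits T P s.+1 x)%N.

Lemma matched_ex P Q x n : (0 < n)%N -> (visits T P n x <= visits T Q n x)%N ->
  exists t, matched P Q x t.
Proof.
case: n => // n _ h.
have ex : exists n, (visits T P n.+1 x <= visits T Q n.+1 x)%N by exists n.
case: (ex_minnP ex) => t ht tmin; exists t; split => // s st.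
by rewrite ltnNge; apply/negP => /tmin; lia.
Qed.

Lemma matched_fun P Q x s t : matched P Q x s -> matched P Q x t -> s = t.
Proof.
move=> [hs ns] [ht nt]; case: (ltngtP s t) => // h.
  by have := nt _ h; lia.
by have := ns _ h; lia.
Qed.

(** The excess of openings over closings moves by at most one per step, so when it first fails to be
    positive it is zero and the step closes. For [t = 0] the point lies in both sets. *)
Lemma matched_hit P Q x t : P x -> matched P Q x t ->
  visits T P t.+1 x = visits T Q t.+1 x /\ Q (iter t T x).
Proof.
move=> Px [ht nt]; case: t ht nt => [|t] ht nt.
  by move: ht; rewrite /= (asboolT Px); case: asboolP.
have := nt t (ltnSn t); move: ht; rewrite !(visitsS _ _ t.+1).
by case: asboolP => p; case: asboolP => q /= {}ht {}nt; try (exfalso; lia); split=> //; lia.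
Qed.

(** Say [t < s]. The stretches from [x] and from [y] to the common endpoint are both balanced, hence
    so is the stretch from [x] to just before [y], against the minimality of [s]. *)
Lemma matched_inj P Q x y s t : P x -> P y -> matched P Q x s -> matched P Q y t ->
  iter s T x = iter t T y -> x = y.
Proof.
wlog ts : x y s t / (t <= s)%N => [H|] Px Py xs yt e.
  by case: (leqP t s) => [|/ltnW] h; [exact: (H x y s t)|apply/esym; exact: (H y x t s)].
have yE := iter_eqB TK ts e.
case: (posnP (s - t)%N) => [st0|st0]; first by rewrite st0 /= in yE.
have [xe _] := matched_hit Px xs; have [ye _] := matched_hit Py yt.
exfalso; case: xs => _ /(_ (s - t).-1); rewrite prednK //.
have sE : s.+1 = ((s - t) + t.+1)%N by lia.
move: xe; rewrite sE !visitsD -yE ye => xe h.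
by have := h _; lia.
Qed.

Variables (P Q : nat -> set X) (Z Y : set X).
Hypothesis YT : forall x, Y x -> Y (T x).
Hypothesis Pcover : forall x, Y x -> exists j, P j x.
Hypothesis Pinj : forall i j x, P i x -> P j x -> i = j.
Hypothesis Qinj : forall i j x, Q i x -> Q j x -> i = j.
Hypothesis QZ : forall j x, Q j x -> ~ Z x.
Hypothesis matchP : forall j x, Y x -> P j x -> exists t, matched (P j) (Q j) x t.

(** The default 0 makes [jump] the identity where no match exists; on [Y] a match always exists. *)
Definition jump x :=
  iter (xget 0%N [set t | exists j, P j x /\ matched (P j) (Q j) x t]) T x.

Lemma jumpE j t x : P j x -> matched (P j) (Q j) x t -> jump x = iter t T x.
Proof.
move=> Pj m; congr (iter _ _ _); apply: xget_unique; first by exists j.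
move=> s [i [Pi mi]]; have ij := Pinj Pi Pj; subst i; exact: matched_fun mi m.
Qed.

Lemma jumpP x : Y x ->
  exists j t, [/\ P j x, matched (P j) (Q j) x t & jump x = iter t T x].
Proof.
move=> Yx; have [j Pj] := Pcover Yx; have [t m] := matchP Yx Pj.
by exists j, t; split=> //; exact: jumpE m.
Qed.

Lemma jump_in x : Y x -> Y (jump x).
Proof. by move=> Yx; have [j [t [_ _ ->]]] := jumpP Yx; exact: iterY. Qed.

Lemma iter_jump_in n x : Y x -> Y (iter n jump x).
Proof. by move=> Yx; elim: n => //= n; exact: jump_in. Qed.

Lemma jump_notin x : Y x -> ~ Z (jump x).
Proof.
move=> Yx; have [j [t [Pj m ->]]] := jumpP Yx.
by have [_ /QZ] := matched_hit Pj m.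
Qed.

Lemma jump_inj x y : Y x -> Y y -> jump x = jump y -> x = y.
Proof.
move=> Yx Yy; have [i [s [Pi mi ->]]] := jumpP Yx; have [j [t [Pj mj ->]]] := jumpP Yy.
move=> e; have [_ Qi] := matched_hit Pi mi; have [_ Qj] := matched_hit Pj mj.
rewrite e in Qi; have ij := Qinj Qi Qj; subst j.
exact: matched_inj Pi Pj mi mj e.
Qed.

(** Cancelling common jumps by injectivity leaves, unless [m = n], a point of [Z] that is a jump
    image; but jump images of points of [Y] avoid [Z]. *)
Lemma iter_jump_inj m n x y : Y x -> Y y -> Z x -> Z y ->
  iter m jump x = iter n jump y -> m = n /\ x = y.
Proof.
move=> Yx Yy Zx Zy; elim: m n => [|m IH] [|n] //= e.
- by exfalso; apply: (@jump_notin (iter n jump y)); [exact: iter_jump_in|rewrite -e].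
- by exfalso; apply: (@jump_notin (iter m jump x)); [exact: iter_jump_in|rewrite e].
- have /IH[-> ->] // : iter m jump x = iter n jump y.
  by apply: jump_inj e; exact: iter_jump_in.
Qed.

(* The images of [Z] under the iterates of [jump] are pairwise disjoint, so a
   single set can record countably many subsets [D n] of [Z]. *)
Definition record (D : nat -> set X) : set X :=
  [set y | exists n, exists x, ((Y x /\ Z x) /\ D n x) /\ y = iter n jump x].

Lemma record_decode D n x : Y x -> Z x -> (record D (iter n jump x) <-> D n x).
Proof.
move=> Yx Zx; split=> [[m [y [[[Yy Zy] Dy] e]]]|Dx]; last by exists n, x.
by have [-> ->] := iter_jump_inj Yx Yy Zx Zy e.
Qed.

Section MatchingSigma.
Variable G : set (set X).
Hypothesis sG : sigma_algebra [set: X] G.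
Hypothesis GT : forall A, G A -> G [set x | A (T x)].
Hypothesis GY : G Y.
Hypothesis GP : forall j, G [set x | Y x /\ P j x].
Hypothesis GQ : forall j, G [set x | Y x /\ Q j x].

Lemma matched_sigma j t : G [set x | Y x /\ matched (P j) (Q j) x t].
Proof.
(* Only traces on [Y] are known to lie in [G]; by invariance they give the same counts from points
   of [Y]. *)
pose P' := [set x | Y x /\ P j x]; pose Q' := [set x | Y x /\ Q j x].
have vE (A : set X) n x : Y x ->
    visits T [set x | Y x /\ A x] n x = visits T A n x.
  move=> Yx; apply/eqP; rewrite eqn_leq; apply/andP.
  by split; apply: visits_sub => i /=; [case|split=> //; exact: iterY].
apply: (@sigma_ext _ _ (fun x => Y x /\
    (visits T P' t.+1 x <= visits T Q' t.+1 x)%N /\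
    forall s, (s < t)%N -> (visits T Q' s.+1 x < visits T P' s.+1 x)%N)).
  by move=> x; split=> -[Yx]; rewrite /matched !vE // => -[? h];
    split=> //; split=> // s /h; rewrite !vE.
repeat sigma_step sG.
  exact: (visits_sigma2 sG GT (fun a b => (a <= b)%N) t.+1 t.+1 (GP j) (GQ j)).
exact: (visits_sigma2 sG GT (fun a b => (a < b)%N) _ _ (GQ j) (GP j)).
Qed.

Lemma jump_sigma A : G [set x | Y x /\ A x] -> G [set x | Y x /\ A (jump x)].
Proof.
move=> gA; apply: (@sigma_ext _ _ (fun x => exists j t, (Y x /\ P j x) /\
    (Y x /\ matched (P j) (Q j) x t) /\ (Y (iter t T x) /\ A (iter t T x)))).
  move=> x; split=> [[j [t [[Yx Pj] [[_ m] [_ At]]]]]|[Yx]].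
    by rewrite (jumpE Pj m).
  have [j [t [Pj m ->]]] := jumpP Yx => At; exists j, t; split=> //; split=> //.
  by split=> //; exact: iterY.
by repeat (exact: GP || exact: matched_sigma || exact: (sigma_iter GT _ gA) || sigma_step sG).
Qed.

Lemma iter_jump_sigma A n : G [set x | Y x /\ A x] ->
  G [set x | Y x /\ A (iter n jump x)].
Proof.
elim: n A => // n IH A gA.
by apply: (IH [set x | A (jump x)]); exact: jump_sigma.
Qed.

Hypothesis GU : forall A, G A -> G [set x | A (U x)].

(** The origin of a jump of length [t] ending at [y] is [iter t U y], so quantifying over [j] and
    [t] suffices. *)
Lemma jump_image_sigma A : G [set x | Y x /\ A x] ->
  G [set y | exists x, (Y x /\ A x) /\ y = jump x].
Proof.
move=> gA; apply: (@sigma_ext _ _ (fun y => exists j t,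
    (Y (iter t U y) /\ P j (iter t U y)) /\
    (Y (iter t U y) /\ matched (P j) (Q j) (iter t U y) t) /\
    (Y (iter t U y) /\ A (iter t U y)))).
  move=> y; split=> [[j [t [[Yx Pj] [[_ m] [_ At]]]]]|[x [[Yx Ax] ->]]].
    by exists (iter t U y); rewrite (jumpE Pj m) iterKV.
  have [j [t [Pj m ->]]] := jumpP Yx.
  by exists j, t; rewrite iterK.
apply: (sigma_exists sG) => j; apply: (sigma_exists sG) => t.
apply: (sigma_and sG); first exact: (sigma_iter GU t (GP j)).
apply: (sigma_and sG); last exact: (sigma_iter GU t gA).
exact: (sigma_iter GU t (matched_sigma j t)).
Qed.

Lemma record_sigma D : G Z -> (forall n, G (D n)) -> G (record D).
Proof.
move=> gZ gD; apply: (sigma_exists sG) => n.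
move: {D gD}(D n) (gD n) => D gA; elim: n D gA => [|n IH] D gA.
  apply: (@sigma_ext _ _ (fun x => (Y x /\ Z x) /\ D x)).
    by move=> x; split=> [h|[y [? ->]]//]; exists x.
  by repeat sigma_step sG.
pose E := [set y | exists x, ((Y x /\ Z x) /\ D x) /\ y = iter n jump x].
apply: (@sigma_ext _ _ (fun y => exists x, (Y x /\ E x) /\ y = jump x)).
  move=> y; split=> [[x [[Yx [z [zD ->]]] ->]]|[z [[[Yz Zz] Dz] ->]]].
    by exists z.
  exists (iter n jump z); split=> //; split; first exact: iter_jump_in.
  by exists z.
apply: jump_image_sigma; apply: (sigma_and sG) => //; exact: IH.
Qed.

End MatchingSigma.
End Matching.

(** * Coding and decoding *)

Section Coding.
Variables (X : Type) (T U : X -> X).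
Hypotheses (TK : cancel T U) (UK : cancel U T).
Variables (C : nat -> set X) (Y : set X).
Hypothesis YT : forall x, Y x -> Y (T x).
Hypothesis YU : forall x, Y x -> Y (U x).
Hypothesis CY : forall x N, Y x ->
  exists k, C k x /\ forall j, (0 < j < N)%N -> ~ C k (iter j T x).
Variables (k : X -> nat) (W : set X) (V : nat -> set X).
Hypothesis kT : forall x, k (T x) = k x.

Local Notation level := (level T U C).
Local Notation layer := (layer T U C).

(** A visit to [captured j] comes from one to [V j] at one of [2 * layerbound j + 1] delays, while
    [layer j] is met in every window of [(layerbound j).+1] steps; the leading 2 absorbs boundary
    terms. *)
Definition rarity j :=
  (2 * (2 * layerbound j + 1) * (layerbound j).+1)%N.

Hypothesis coverY : forall x, Y x -> W x \/ exists2 j, (k x < j)%N & V j x.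
Hypothesis W_freq : forall x, Y x -> exists N, forall n, (N <= n)%N ->
  (sepbound (k x) * visits T W n x + 2 * n <= sepbound (k x) * n)%N.
Hypothesis V_freq : forall x j, Y x -> (k x < j)%N ->
  exists N, forall n, (N <= n)%N -> (rarity j * visits T (V j) n x <= n)%N.

Lemma iter_k n x : k (iter n T x) = k x.
Proof. by elim: n => //= n IH; rewrite kT. Qed.

Lemma iter_YU n x : Y x -> Y (iter n U x).
Proof. by move=> Yx; elim: n => //= n; exact: YU. Qed.

(** One set serves all [j], since the layer containing [q] determines [j]. *)
Definition active : set X :=
  [set q | exists j, layer j q /\ exists i, (i <= layerbound j)%N /\ V j (iter i U q)].

Definition captured j : set X :=
  [set y | exists i, (i <= layerbound j)%N /\
                     layer j (iter i T y) /\ active (iter i T y)].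

Definition source j : set X :=
  [set y | k y = j /\ (forall l, (j < l)%N -> ~ captured l y) \/
           (k y < j)%N /\ captured j y /\
             forall l, (k y < l < j)%N -> ~ captured l y].

(** Layers beyond [k y] lie inside [level (k y)], so the targets are disjoint; none meets
    [layer (k y)], the reserve. *)
Definition target j : set X :=
  [set y | k y = j /\ ~ level j y \/ (k y < j)%N /\ layer j y].

Definition reserve : set X := [set y | layer (k y) y].

Lemma captured_V j x : Y x -> V j x -> captured j x.
Proof.
move=> Yx Vx; have [i iM li] := layer_gap TK UK YT CY j Yx.
by exists i; split => //; split => //; exists j; split=> //; exists i; rewrite iterK.
Qed.

(** A captured point sees a marked point at most [layerbound j] steps ahead, which follows [V j] by
    at most as many. Starting [layerbound j] steps before [x] keeps the delay nonnegative. *)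
Lemma captured_near j x i : captured j (iter i T x) ->
  exists2 d, (d < 2 * layerbound j + 1)%N &
    V j (iter (d + i) T (iter (layerbound j) U x)).
Proof.
move=> [a [aM [la [j' [lj [b [bM Vb]]]]]]].
have ? := layer_inj lj la; subst j'.
exists (layerbound j + a - b)%N; first by lia.
move: Vb; congr (V j _); apply: (can_inj (iterK TK b)); rewrite iterKV // -!iterD.
rewrite (_ : (b + _)%N = (a + i) + layerbound j)%N; last by lia.
by rewrite (iterD (a + i)) iterKV.
Qed.

Lemma source_ex x : Y x -> exists j, source j x.
Proof.
move=> Yx; case: (pselect (exists l, (k x < l)%N /\ captured l x)) => [[l [kl cl]]|no].
  have ex : exists l, (k x < l)%N && `[< captured l x >].
    by exists l; rewrite kl; exact/asboolP.
  case: (ex_minnP ex) => j /andP[kj /asboolP cj] jmin.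
  exists j; right; split=> //; split=> // i /andP[ki ij] ci.
  by have := jmin i; rewrite ki asboolT // => /(_ isT); lia.
by exists (k x); left; split => // l kl cl; apply: no; exists l.
Qed.

Lemma source_inj i j x : source i x -> source j x -> i = j.
Proof.
move=> [[ki ni]|[ki [ci ni]]] [[kj nj]|[kj [cj nj]]].
- by rewrite -ki -kj.
- by exfalso; apply: (ni j) => //; lia.
- by exfalso; apply: (nj i) => //; lia.
- case: (ltngtP i j) => // h; exfalso.
    by apply: (nj i) => //; rewrite ki.
  by apply: (ni j) => //; rewrite kj.
Qed.

Lemma target_inj i j x : target i x -> target j x -> i = j.
Proof.
move=> [[ki ni]|[ki li]] [[kj nj]|[kj lj]].
- by rewrite -ki -kj.
- exfalso; apply: ni; apply: (@level_sub _ _ _ _ _ j); first by lia.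
  by case: lj.
- exfalso; apply: nj; apply: (@level_sub _ _ _ _ _ i); first by lia.
  by case: li.
- exact: layer_inj li lj.
Qed.

Lemma target_reserve j x : target j x -> ~ reserve x.
Proof.
move=> [[<- n] [h _]|[kj lj] z]; first exact: n.
by have := layer_inj lj z; lia.
Qed.

Lemma source_matched j x : Y x -> source j x ->
  exists t, matched T (source j) (target j) x t.
Proof.
move=> Yx [[kj _]|[kj _]].
  have [N fW] := W_freq Yx; rewrite kj in fW.
  have g0 : (0 < sepbound j)%N by case: (j) => //= m; lia.
  (* For [n] at least [sepbound j], the visits to [level j] number at most [2 * n / sepbound j],
     exactly the room left by [W_freq]. *)
  pose n := maxn N (sepbound j).
  apply: (@matched_ex _ _ _ _ _ n); first by rewrite /n; lia.
  have sW : (visits T (source j) n x <= visits T W n x)%N.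
    apply: visits_sub => i [[ki nc]|[]]; last by rewrite iter_k; lia.
    (* A point of [V l] with [l] beyond [k] is captured at [l], so an uncaptured point lies in
       [W]. *)
    have [//|[l kl Vl]] := coverY (iterY YT i Yx).
    exfalso; apply: (nc l); first by rewrite -ki.
    by apply: captured_V => //; exact: iterY.
  have tL : (visits T [set y | ~ level j y] n x <= visits T (target j) n x)%N.
    by apply: visits_sub => i nl; left; rewrite iter_k.
  have := visitsC T (level j) n x.
  have := visits_spaced n x (@level_spaced _ T U TK C j) g0.
  have := fW n (leq_maxl _ _); have : (sepbound j <= n)%N by exact: leq_maxr.
  by nia.
set M := layerbound j.
have kM : (k (iter M U x) < j)%N by rewrite -(iter_k M) iterKV.
have [N fV] := V_freq (iter_YU M Yx) kM.
(* [N.+1] windows of length [M.+1] contain at least [N.+1] visits to the target. *)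
apply: (@matched_ex _ _ _ _ _ (N.+1 * M.+1)%N); first by lia.
have tL : (N.+1 <= visits T (target j) (N.+1 * M.+1) x)%N.
  have gap i : exists2 d, (d <= M)%N & layer j (iter (d + i) T x).
    have [d dM ld] := layer_gap TK UK YT CY j (iterY YT i Yx).
    by exists d; rewrite ?iterD.
  apply: leq_trans (visits_syndetic N.+1 gap) _.
  by apply: visits_sub => i li; right; rewrite iter_k.
apply: leq_trans tL; set n := (N.+1 * M.+1)%N.
have sC : (visits T (source j) n x <= visits T (captured j) n x)%N.
  by apply: visits_sub => i [[]|[_ []]] //; rewrite iter_k; lia.
have sV := visits_spread n (fun i => @captured_near j x i).
have := fV (n + (2 * M + 1))%N; rewrite -/M in sV.
move=> /(_ ltac:(rewrite /n; nia)); rewrite /rarity -/M.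
move: sC sV; set a := visits _ _ _ _; set b := visits _ _ _ _.
set c := visits _ _ _ _ => ab bc hc.
have {}hc : (2 * M.+1 * b <= n + (2 * M + 1))%N by nia.
(* Rarity bounds [2 * M.+1 * b] by [N.+1 * M.+1 + 2 * M + 1], which is below [(N.+1 + 2) * M.+1]. *)
suff : (2 * b < N.+1 + 2)%N by lia.
rewrite -(ltn_pmul2r (ltn0Sn M)); move: hc; rewrite /n; nia.
Qed.

Lemma reserve_hit x : Y x -> exists i, reserve (iter i T x).
Proof.
move=> Yx; have [i _ li] := layer_gap TK UK YT CY (k x) Yx.
by exists i; rewrite /reserve /= iter_k.
Qed.

(* Stored at a point [x] of [reserve]: membership of all backward iterates
   of [x] in all the sets [C m]. *)
Definition payload (n : nat) : set X :=
  [set x | if @unpickle (nat * nat)%type n is Some p then C p.1 (iter p.2 U x)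
           else False].

Definition tape : set X := record T source target reserve Y payload.

(** * Decoding along forward orbits *)

Section Decode.
Variable G : set (set X).
Hypothesis sG : sigma_algebra [set: X] G.
Hypothesis GT : forall A, G A -> G [set x | A (T x)].
Hypotheses (GY : G Y) (GS : G (successors T U C)) (GA : G active) (GZ : G reserve).

Lemma level_in n : G [set x | Y x /\ level n x].
Proof. exact: level_decode. Qed.

Lemma layer_in n : G [set x | Y x /\ layer n x].
Proof.
have := sigma_and sG (level_in n) (sigma_setC sG (level_in n.+1)).
apply: sigma_ext => x; split=> [[[Yx ln] nl]|[Yx [ln nl]]].
  by do 2!split=> //; move=> ln'; apply: nl.
by split; [split|move=> [_ /nl]].
Qed.

Lemma layer_iter_in n i : G [set x | Y x /\ layer n (iter i T x)].
Proof.
have := sigma_and sG GY (sigma_iter GT i (layer_in n)).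
by apply: sigma_ext => x; split=> [[Yx []]|[Yx ln]]; split=> //; split=> //; exact: iterY.
Qed.

(** A forward orbit in [Y] meets [reserve], and only inside the layer of index [k x], so the layer
    of any such point reveals [k x]. *)
Lemma k_in j : G [set x | Y x /\ k x = j].
Proof.
apply: (@sigma_ext _ _ (fun x => exists i, (Y x /\ layer j (iter i T x)) /\
                                            reserve (iter i T x))).
  move=> x; split=> [[i [[Yx lj] lk]]|[Yx kx]].
    by split=> //; rewrite -(layer_inj lk lj) iter_k.
  by have [i _ li] := layer_gap TK UK YT CY j Yx; exists i; rewrite /reserve /= iter_k kx.
by repeat (exact: layer_iter_in || exact: (sigma_iter GT) || sigma_step sG).
Qed.

Lemma k_lt_in j : G [set x | Y x /\ (k x < j)%N].
Proof.
apply: (@sigma_ext _ _ (fun x => exists i, (i < j)%N /\ Y x /\ k x = i)).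
  by move=> x; split=> [[i [ij [Yx ->]]] //|[Yx kj]]; exists (k x).
by repeat (exact: k_in || sigma_step sG).
Qed.

Lemma captured_in j : G [set x | Y x /\ captured j x].
Proof.
apply: (@sigma_ext _ _ (fun x => exists i, (i <= layerbound j)%N /\
   (Y x /\ layer j (iter i T x)) /\ active (iter i T x))).
  by move=> x; split=> [[i [? [[? ?] ?]]]|[? [i [? [? ?]]]]]; [split=> //|]; exists i.
by repeat (exact: layer_iter_in || exact: (sigma_iter GT) || sigma_step sG).
Qed.

Lemma source_in j : G [set x | Y x /\ source j x].
Proof.
apply: (@sigma_ext _ _ (fun x =>
   (Y x /\ k x = j) /\ (forall l, (j < l)%N -> ~ (Y x /\ captured l x)) \/
   (Y x /\ (k x < j)%N) /\ (Y x /\ captured j x) /\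
     forall l, (l < j)%N -> (exists i, (i < l)%N /\ Y x /\ k x = i) ->
       ~ (Y x /\ captured l x))).
  move=> x; split.
    case=> [[[Yx kj] nc]|[[Yx kj] [[_ cj] nc]]]; split=> //; [left|right].
      by split=> // l jl cl; apply: (nc l).
    split=> //; split=> // l /andP[kl lj] cl; apply: (nc l lj) => //.
    by exists (k x).
  move=> [Yx [[kj nc]|[kj [cj nc]]]]; [left|right].
    by split=> // l jl [_ cl]; apply: (nc l).
  split=> //; split=> // l lj [i [il [_ ki]]] [_]; apply: nc; lia.
by repeat (exact: k_in || exact: k_lt_in || exact: captured_in || sigma_step sG).
Qed.

Lemma target_in j : G [set x | Y x /\ target j x].
Proof.
apply: (@sigma_ext _ _ (fun x => (Y x /\ k x = j) /\ ~ (Y x /\ level j x) \/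
  (Y x /\ (k x < j)%N) /\ (Y x /\ layer j x))).
  move=> x; split.
    case=> [[[Yx kj] nl]|[[Yx kj] [_ lj]]]; split=> //; [left|right] => //.
    by split=> // l; apply: nl.
  by move=> [Yx [[kj nl]|[kj lj]]]; [left|right]; split=> // -[].
by repeat (exact: k_in || exact: k_lt_in || exact: layer_in || exact: level_in
           || sigma_step sG).
Qed.

Hypothesis GB : G tape.

(** Once sources and targets are decoded, so is [jump]; the tape is then read at the [n]-th jump of
    a reserve point. *)
Lemma payload_in n : G [set x | Y x /\ (reserve x /\ payload n x)].
Proof.
have gB := iter_jump_sigma YT source_ex source_inj source_matched sG GT
  GY source_in target_in n (sigma_and sG GY GB).
have := sigma_and sG gB GZ; apply: sigma_ext => x.
have dec := record_decode TK YT source_ex source_inj target_inj target_reserve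
  source_matched payload n.
by split=> [[[Yx Bx] Zx]|[Yx [Zx Dx]]]; split=> //; split=> //; apply/(dec x Yx Zx).
Qed.

(** A later reserve point [iter i T x] stores its backward history, and its [i]-th backward iterate
    is [x]. *)
Lemma base_in m : G [set x | Y x /\ C m x].
Proof.
apply: (@sigma_ext _ _ (fun x => Y x /\ exists i, Y (iter i T x) /\
   (reserve (iter i T x) /\ payload (pickle (m, i)) (iter i T x)))).
  move=> x; rewrite /payload /=; split=> [[Yx [i [_ [_]]]]|[Yx Cx]].
    by rewrite pickleK /= iterK.
  split=> //; have [i Zi] := reserve_hit Yx; exists i; split; first exact: iterY.
  by rewrite pickleK /= iterK.
apply: (sigma_and sG) => //; apply: (sigma_exists sG) => i.
exact: (sigma_iter GT i (payload_in _)).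
Qed.

End Decode.

(** * Measurability of the four coding sets *)

Section Encode.
Variable G : set (set X).
Hypothesis sG : sigma_algebra [set: X] G.
Hypothesis GT : forall A, G A -> G [set x | A (T x)].
Hypothesis GU : forall A, G A -> G [set x | A (U x)].
Hypothesis GY : G Y.
Hypothesis GC : forall m, G (C m).
Hypothesis GV : forall j, G (V j).
Hypothesis Gk : forall j, G [set x | k x = j].

Lemma level_sigma n : G (level n).
Proof.
elim: n => [|n IH]; first exact: (sigma_cst sG True).
exact: (marker_sigma sG GT GU).
Qed.

Lemma layer_sigma n : G (layer n).
Proof.
apply: (sigma_and sG); first exact: level_sigma.
exact: (sigma_setC sG (level_sigma n.+1)).
Qed.

Lemma successors_sigma : G (successors T U C).
Proof.
by repeat (exact: layer_sigma || exact: (sigma_iter GU _ (level_sigma _))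
           || sigma_step sG).
Qed.

Lemma active_sigma : G active.
Proof.
by repeat (exact: layer_sigma || exact: (sigma_iter GU _ (GV _)) || sigma_step sG).
Qed.

Lemma reserve_sigma : G reserve.
Proof.
apply: (@sigma_ext _ _ (fun x => exists j, k x = j /\ layer j x)).
  by move=> x; split=> [[j [<-]]|]//; exists (k x).
by repeat (exact: layer_sigma || exact: Gk || sigma_step sG).
Qed.

(** The first three sets being in [G], the decoding lemmas already place the sources and targets
    there. *)
Lemma tape_sigma : G tape.
Proof.
apply: (record_sigma TK UK YT source_ex source_inj source_matched sG GT) => //.
- apply: source_in => //; [exact: successors_sigma|exact: active_sigma|exact: reserve_sigma].
- apply: target_in => //; [exact: successors_sigma|exact: reserve_sigma].
- exact: reserve_sigma.
- move=> n; rewrite /payload; case: unpickle => [p|]; last by case: sG.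
  exact: (sigma_iter GU _ (GC _)).
Qed.

End Encode.
End Coding.

(** * Countable bases *)

(** The base consists of interiors of balls of radius [1/(p+1)] around a countable dense set. It
    generates because open sets are countable unions of base sets, and separates a point from
    finitely many others because finite sets are closed. *)
Lemma standard_borel_base (R : realType) d (X : measurableType d) :
  standard_borel R X -> exists C : nat -> set X,
  [/\ forall n, measurable (C n),
      forall G : set (set X), sigma_algebra [set: X] G -> (forall n, G (C n)) ->
        forall A, measurable A -> G A &
      forall (x : X) (N : nat) (y : nat -> X), (forall j, (j < N)%N -> y j <> x) ->
        exists n, C n x /\ forall j, (j < N)%N -> ~ C n (y j)].
Proof.
move=> [M [f [[_ [D cD dD]] [h fK hK] mE]]].
have [e einj] := countable_injP _ cD.
pose b p (q : M) : set M := interior (ball q (p.+1%:R^-1 : R)).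
pose B n : set M := if (unpickle n : option (nat * nat)) is Some p then
  [set z | exists2 q, D q & e q = p.1 /\ b p.2 q z] else set0.
have oB n : open (B n).
  rewrite /B; case: unpickle => [p|]; last exact: open0.
  rewrite (_ : [set z | _] = \bigcup_(q in [set q | D q /\ e q = p.1]) b p.2 q).
    by apply: bigcup_open => q _; exact: open_interior.
  by apply/seteqP; split => z [q]; [move=> Dq [? ?]|move=> [? ?] ?]; exists q.
have baseB (O : set M) z : open O -> O z -> exists n, B n z /\ B n `<=` O.
  move=> oO Oz; have /nbhs_ballP[_/posnumP[eps] ballO] : nbhs z O.
    by apply: open_nbhs_nbhs; split.
  have [//|N] := @ltr_add_invr R 0%R (eps%:num/2)%R _; rewrite add0r => Neps.
  (* With [q] within half the radius of [z], the ball of radius [1/(N+1)] around [q] contains a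
     neighbourhood of [z] yet stays within [eps] of [z]. *)
  have rpos : (0 < N.+1%:R^-1 / 2 :> R)%R by rewrite divr_gt0.
  have [q [qz Dq]] : (interior (ball z (N.+1%:R^-1 / 2 : R)) `&` D) !=set0.
    by apply: dD; [exists z; exact: nbhsx_ballx|exact: open_interior].
  have {}qz := interior_subset qz.
  exists (pickle (e q, N)); rewrite /B pickleK /=; split.
    exists q => //; split=> //.
    apply: (@filterS _ _ _ (ball z (N.+1%:R^-1 / 2 : R))); last exact: nbhsx_ballx.
    move=> w zw; rewrite [X in ball q X](splitr N.+1%:R^-1%R).
    by apply: ball_triangle zw; exact: ball_sym.
  move=> w [q' Dq' [eqq /interior_subset qw]]; apply: ballO.
  have ? : q' = q by apply: einj; rewrite ?inE.
  subst q'; rewrite [(_%:num)%R]splitr; apply: (@ball_triangle _ _ q).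
    apply: (le_ball _ qz); apply: ltW; apply: le_lt_trans Neps.
    by rewrite ler_pdivrMr// ler_peMr// ?invr_ge0// ler1n.
  by apply: (le_ball _ qw); exact: ltW.
exists (fun n => f @^-1` B n); split.
- by move=> n; apply/mE; exact: sub_sigma_algebra.
- move=> G sG GB A mA.
  have AE : A = f @^-1` (h @^-1` A) by apply/seteqP; split => x /=; rewrite fK.
  have sAE : <<s open >> (h @^-1` A) by apply/mE; rewrite -AE.
  rewrite AE; pose G' := [set E : set M | G (f @^-1` E)].
  suff : <<s open >> `<=` G' by apply.
  apply: smallest_sub.
    split; first by rewrite /G' /= preimage_set0; case: sG.
      move=> E GE; have := sigma_setC sG GE; congr G; apply/seteqP.
      by split => x //= [].
    move=> F GF; have := sigma_exists sG GF; congr G; apply/seteqP.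
    by split => x; [move=> [n Fn]; exists n|move=> [n _ Fn]; exists n].
  move=> O oO; apply: (@sigma_ext _ _ (fun x => exists n, B n `<=` O /\ B n (f x))).
    move=> x; split=> [[n [BO /BO]]//|Ox].
    by have [n [Bx BO]] := baseB O (f x) oO Ox; exists n.
  by repeat (exact: GB || sigma_step sG).
- move=> x N y yx.
  pose O : set M := [set z | forall j, (j < N)%N -> f (y j) <> z].
  have oO : open O.
    rewrite /O; elim: (N) => [|n IH].
      by rewrite (_ : [set _ | _] = setT); [exact: openT|apply/seteqP; split].
    rewrite (_ : [set _ | _] = [set z | forall j, (j < n)%N -> f (y j) <> z] `&`
        ~` [set f (y n)]).
      apply: openI => //; apply: closed_openC.
      apply: accessible_closed_set1; apply: hausdorff_accessible.
      exact: metric_hausdorff.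
    apply/seteqP; split => z /=.
      move=> H; split=> [j jn|e0]; first by apply: H; exact: ltnW.
      by apply: (H n).
    move=> [H n0] j; rewrite ltnS leq_eqVlt => /predU1P[->|/H//].
    by move=> e0; apply: n0.
  have Ox : O (f x).
    by move=> j jN /(can_inj fK) e0; apply: (yx j).
  have [n [Bx BO]] := baseB O (f x) oO Ox; exists n; split => // j jN /BO/(_ j jN).
  by apply.
Qed.

(** * Generators from four sets *)

Section Assembly.
Variables (d : measure_display) (X : measurableType d) (T U : X -> X).
Hypotheses (TK : cancel T U) (UK : cancel U T).
Variable Y : set X.
Hypothesis YT : forall x, Y (T x) <-> Y x.
Hypothesis mT : forall A, measurable A -> measurable [set x | A (T x)].
Hypothesis mU : forall A, measurable A -> measurable [set x | A (U x)].

Lemma invariant_iter n x : Y (iter n T x) <-> Y x.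
Proof. by elim: n => //= n <-; exact: YT. Qed.

Lemma iterz_image_preimage j (A : set X) :
  exists j', T @^-1` (iterz_image T j A) = iterz_image T j' A.
Proof.
case: j => [[|n]|n].
- by exists (Negz 0); apply/seteqP; split => x /=; [move=> [y Ay <-]|exists (T x)].
- exists (Posz n); apply/seteqP; split => x /=.
    by move=> [y Ay] /(can_inj TK) <-; exists y.
  by move=> [y Ay <-]; exists y.
- by exists (Negz n.+1); apply/seteqP; split => x /=; rewrite -iterSr.
Qed.

Section TraceFamily.
Variables (k : nat) (B : 'I_k -> set X).
Hypothesis mB : forall i, measurable (B i).
Hypothesis BY : forall i, B i `<=` Y.
Hypothesis mY : measurable Y.

Local Notation translates :=
  [set S | exists (j : int) (i : 'I_k), S = iterz_image T j (B i)].

Lemma translates_sub : <<s Y, translates >> `<=` strace measurable Y.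
Proof.
apply: smallest_sub; first by apply: sigma_algebra_strace; exact: sigma_algebra_measurable.
move=> S [j [i ->]]; exists (iterz_image T j (B i)).
  case: j => n /=; last exact: (sigma_iter mT n.+1 (mB i)).
  have := sigma_iter mU n (mB i); congr measurable; apply/seteqP; split => x /=.
    by move=> h; exists (iter n U x) => //; rewrite iterKV.
  by move=> [y By <-]; rewrite iterK.
apply/setIidl; case: j => n x /=.
  by move=> [y /BY Yy <-]; apply/invariant_iter.
by move=> /BY Yx; apply/(invariant_iter n.+1).
Qed.

(** Turns the sigma-algebra generated on [Y] into one on [X], the form required for decoding. *)
Definition trace_family : set (set X) := [set A | <<s Y, translates >> (A `&` Y)].

Lemma trace_family_sigma : sigma_algebra [set: X] trace_family.
Proof.
have [s0 sC sU] := smallest_sigma_algebra Y translates; split.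
- by rewrite /trace_family /= set0I.
- move=> A /sC; congr (<<s _, _ >> _).
  by apply/seteqP; split => x /=; [move=> [Yx nA]|move=> [[_ nA] Yx]];
    split=> //; [split=> // Ax; apply: nA|move=> [/nA]].
- by move=> F FG; rewrite /trace_family /= setI_bigcupl; exact: sU.
Qed.

(** The sets whose [T]-preimage is generated form a sigma-algebra on [Y], by invariance, and include
    all translates. *)
Lemma trace_family_preimage A : trace_family A -> trace_family [set x | A (T x)].
Proof.
rewrite /trace_family /=; set E := A `&` Y.
rewrite (_ : [set x | A (T x)] `&` Y = T @^-1` E); last first.
  by apply/seteqP; split => x /= [? ?]; split=> //; exact/YT.
pose H := [set E | <<s Y, translates >> (T @^-1` E)].
suff : <<s Y, translates >> `<=` H by apply.
have [s0 sC sU] := smallest_sigma_algebra Y translates.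
apply: smallest_sub.
  split; first by rewrite /H /= preimage_set0.
    move=> F /sC; rewrite /H /=; congr (<<s _, _ >> _).
    by apply/seteqP; split => x /= [? ?]; split=> //; exact/YT.
  by move=> F FH; rewrite /H /= preimage_bigcup; exact: sU.
move=> S [j [i ->]]; rewrite /H /=; have [j' ->] := iterz_image_preimage j (B i).
by apply: sub_sigma_algebra; exists j', i.
Qed.

Lemma trace_family_piece i : trace_family (B i).
Proof.
rewrite /trace_family /= setIidl; last exact: BY.
apply: sub_sigma_algebra; exists (Posz 0), i.
by apply/seteqP; split => x /=; [move=> Bx; exists x|move=> [y By <-]].
Qed.

Lemma trace_family_dom : trace_family Y.
Proof.
have [s0 sC _] := smallest_sigma_algebra Y translates.
by rewrite /trace_family /= setIid; have := sC _ s0; rewrite setD0.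
Qed.

Lemma trace_family_generator :
  (forall A, measurable A -> trace_family A) ->
  <<s Y, translates >> = strace measurable Y.
Proof.
move=> mG; apply/seteqP; split; first exact: translates_sub.
by move=> S [A mA <-]; exact: mG.
Qed.

End TraceFamily.

(** The binary digits of [i] tell which of the four sets contain the cell. *)
Definition atom4 (S0 S1 S2 S3 : set X) (i : 'I_16) : set X :=
  [set x | Y x /\ (S0 x <-> odd i) /\ (S1 x <-> odd i./2) /\
           (S2 x <-> odd i./2./2) /\ (S3 x <-> odd i./2./2./2)].

Lemma atom4_generator (S0 S1 S2 S3 : set X) :
  measurable Y -> measurable S0 -> measurable S1 -> measurable S2 -> measurable S3 ->
  (forall G, sigma_algebra [set: X] G ->
    (forall A, G A -> G [set x | A (T x)]) ->
    G Y -> G S0 -> G S1 -> G S2 -> G S3 ->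
    forall A, measurable A -> G [set x | Y x /\ A x]) ->
  exists B : 'I_16 -> set X, set_generator T Y B.
Proof.
move=> mY m0 m1 m2 m3 gen; pose B := atom4 S0 S1 S2 S3.
have BY i : B i `<=` Y by move=> x [].
have mB i : measurable (B i).
  have sM := @sigma_algebra_measurable d X.
  by repeat sigma_step sM.
have cover x : Y x -> exists i, B i x.
  move=> Yx.
  pose n := (`[< S0 x >] + 2 * `[< S1 x >] + 4 * `[< S2 x >] + 8 * `[< S3 x >])%N.
  have n16 : (n < 16)%N by rewrite /n; do 4!case: asboolP => _.
  exists (Ordinal n16); split=> //; rewrite /= /n.
  by case: asboolP => s0; case: asboolP => s1; case: asboolP => s2;
    case: asboolP => s3 /=; do ![split => //].
exists B; split.
  split=> //; last first.
    by apply/seteqP; split => x; [move=> [i _ /BY]|move=> /cover[i Bx]; exists i].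
  move=> i j _ _ [x [[_ [i0 [i1 [i2 i3]]]] [_ [j0 [j1 [j2 j3]]]]]]; apply: val_inj => /=.
  have e (P : Prop) (a b : bool) : (P <-> a) -> (P <-> b) -> a = b.
    by move=> pa pb; apply/idP/idP => [/pa/pb|/pb/pa].
  move: (e _ _ _ i0 j0) (e _ _ _ i1 j1) (e _ _ _ i2 j2) (e _ _ _ i3 j3).
  move: (ltn_ord i) (ltn_ord j) {i0 i1 i2 i3 j0 j1 j2 j3}.
  move: (nat_of_ord i) (nat_of_ord j) => {}i {}j.
  have half4 n : (n < 16)%N -> n./2./2./2./2 = 0%N.
    by do 16!(case: n => [//|n]).
  move=> /half4 i4 /half4 j4 e0 e1 e2 e3.
  rewrite -(odd_double_half i) -(odd_double_half j) e0; congr (_ + _.*2)%N.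
  rewrite -(odd_double_half i./2) -(odd_double_half j./2) e1; congr (_ + _.*2)%N.
  rewrite -(odd_double_half i./2./2) -(odd_double_half j./2./2) e2; congr (_ + _.*2)%N.
  by rewrite -(odd_double_half i./2./2./2) -(odd_double_half j./2./2./2) e3 i4 j4.
apply: trace_family_generator => // A mA.
pose G := trace_family B.
have sG : sigma_algebra [set: X] G := trace_family_sigma B.
have gB n : G (B n) := trace_family_piece BY n.
have gY : G Y by exact: trace_family_dom.
(* On [Y], a set decided by the cell index is a union of cells; [inord] lets this union run over the
   integers. *)
have gbit (S : set X) (p : nat -> bool) :
    (forall i x, B i x -> (S x <-> p i)) -> G S.
  move=> Sp; have gS : G [set x | exists n, p (inord n : 'I_16) /\ B (inord n) x].
    by repeat (exact: gB || sigma_step sG).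
  move: gS; rewrite /G /trace_family /=; congr (<<s _, _ >> _).
  apply/seteqP; split => x /= [h Yx]; split=> //.
    by case: h => n [pn Bx]; apply/(Sp _ _ Bx).
  have [i Bx] := cover x Yx; exists (nat_of_ord i); rewrite inord_val; split=> //.
  exact/(Sp _ _ Bx).
have : G [set x | Y x /\ A x].
  apply: gen => //; first exact: trace_family_preimage.
  - by apply: (gbit _ odd) => i x [_ []].
  - by apply: (gbit _ (fun i => odd i./2)) => i x [_ [_ []]].
  - by apply: (gbit _ (fun i => odd i./2./2)) => i x [_ [_ [_ []]]].
  - by apply: (gbit _ (fun i => odd i./2./2./2)) => i x [_ [_ [_ []]]].
rewrite /G /trace_family /=; congr (<<s _, _ >> _).
by apply/seteqP; split => x /=; [move=> [[]]|move=> []].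
Qed.

End Assembly.

(** * Frequencies *)

(* [least P] is 0 when no integer satisfies [P]. *)
Definition least (P : nat -> Prop) : nat :=
  xget 0%N [set n | P n /\ forall l, (l < n)%N -> ~ P l].

Lemma least_spec (P : nat -> Prop) : (exists n, P n) ->
  P (least P) /\ forall n, P n -> (least P <= n)%N.
Proof.
move=> [n Pn]; have ex : exists n, `[< P n >] by exists n; exact/asboolP.
case: (ex_minnP ex) => m /asboolP Pm mmin.
suff -> : least P = m by split=> // l Pl; apply: mmin; exact/asboolP.
apply: xget_unique.
  by split=> // l lm Pl; have := mmin l; rewrite asboolT// => /(_ isT); lia.
move=> l [Pl ll]; case: (ltngtP l m) => // h; last by exfalso; exact: ll Pm.
by have := mmin l; rewrite asboolT// => /(_ isT); lia.
Qed.

Lemma least_mono (P Q : nat -> Prop) : (exists n, Q n) -> (forall n, Q n -> P n) ->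
  (least P <= least Q)%N.
Proof.
move=> exQ QP; have [Ql _] := least_spec exQ.
by apply: (least_spec _).2; [exists (least Q)|]; exact: QP.
Qed.

Lemma least_sigma (X : Type) (G : set (set X)) (P : nat -> X -> Prop) n :
  sigma_algebra [set: X] G -> (forall n, G [set x | P n x]) ->
  G [set x | least (P ^~ x) = n].
Proof.
move=> sG gP; apply: (@sigma_ext _ _ (fun x =>
   (P n x /\ forall l, (l < n)%N -> ~ P l x) \/ (n = 0%N /\ forall l, ~ P l x))).
  move=> x; split=> [[[Pn nP]|[-> nP]]|<-].
  - have ex : exists n, P n x by exists n.
    have [Pl ll] := least_spec ex; have := ll _ Pn; rewrite leq_eqVlt.
    by move=> /predU1P[//|/nP].
  - by apply: xgetPN => m [/nP].
  - case: (pselect (exists n, P n x)) => [ex|nex]; [left|right].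
      have [Pl ll] := least_spec ex; split=> // l lm Pl'.
      by have := ll l Pl'; lia.
    by split; [apply: xgetPN => m [Pm _]|move=> l Pl]; apply: nex; eexists; eassumption.
by repeat sigma_step sG.
Qed.

Section Frequency.
Variables (R : realType) (d : measure_display) (X : measurableType d).
Variables (T : X -> X) (A : nat -> set X).
Local Notation Y := (deficient_set R T A).
Local Notation freq x i := (visit_frequency R T x (A i)).

Local Open Scope ring_scope.

Lemma visit_averageE (E : set X) x n :
  visit_average R T E x n = n%:R^-1 * (visits T E n x)%:R.
Proof.
congr (_ * _); elim: n => [|n IH]; first by rewrite big_geq.
by rewrite big_nat_recr //= IH natrD.
Qed.

(** The visit counts from [x] and from [T x] differ by at most one. *)
Lemma visit_average_shift (E : set X) x :
  (visit_average R T E (T x) n - visit_average R T E x n) @[n --> \oo] --> (0 : R).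
Proof.
apply/cvgr0Pnorm_le => e e0; near=> n.
have n0 : (0 : R) < n%:R by rewrite ltr0n; near: n; exists 1%N.
rewrite !visit_averageE -mulrBr normrM normfV normr_nat.
apply: (@le_trans _ _ (n%:R^-1 * 1)).
  rewrite ler_pM2l ?invr_gt0 //.
  have : (`[< E x >] + visits T E n (T x) = visits T E n x + `[< E (iter n T x) >])%N.
    by rewrite -visitsS -add1n visitsD.
  case: asboolP => _; case: asboolP => _ /= h.
  - by rewrite (_ : visits T E n (T x) = visits T E n x) ?subrr ?normr0//; lia.
  - by rewrite (_ : visits T E n x = (visits T E n (T x)).+1); [|lia];
      rewrite -natr1 opprD addrA subrr sub0r normrN normr1.
  - by rewrite (_ : visits T E n (T x) = (visits T E n x).+1); [|lia];
      rewrite -natr1 addrAC subrr add0r normr1.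
  - by rewrite (_ : visits T E n (T x) = visits T E n x) ?subrr ?normr0//; lia.
rewrite mulr1 -(invrK e) lef_pV2 ?posrE ?invr_gt0 //.
near: n; exact: nbhs_infty_ger.
Unshelve. all: by end_near. Qed.

Lemma visit_average_cvg_shift (E : set X) x (l : R) :
  visit_average R T E (T x) @ \oo --> l <-> visit_average R T E x @ \oo --> l.
Proof.
have h := @visit_average_shift E x; split => c.
  suff -> : visit_average R T E x = (fun n => visit_average R T E (T x) n -
      (visit_average R T E (T x) n - visit_average R T E x n)).
    by rewrite -[l]subr0; apply: cvgB.
  by apply/funext => n; rewrite opprB addrC subrK.
suff -> : visit_average R T E (T x) = (fun n => visit_average R T E x n +
    (visit_average R T E (T x) n - visit_average R T E x n)).
  by rewrite -[l]addr0; apply: cvgD.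
by apply/funext => n; rewrite addrC subrK.
Qed.

Lemma freq_shift x i : cvgn (@visit_average R X T (A i) x) ->
  freq (T x) i = freq x i.
Proof.
by move=> c; apply/cvg_lim => //; apply/visit_average_cvg_shift.
Qed.

(** A uniform bound on the partial sums replaces the series, leaving only countable quantifiers. *)
Lemma deficient_setP x : Y x <->
  (forall i, cvgn (@visit_average R X T (A i) x) /\ 0 < freq x i) /\
  exists p : nat, forall m, \sum_(0 <= i < m) freq x i <= 1 - p.+1%:R^-1.
Proof.
split=> -[fpos].
  set S := (S in (S < 1)%E) => S1; split=> //.
  have S_ge m : ((\sum_(0 <= i < m) freq x i)%:E <= S)%E.
    rewrite -sumEFin; apply: nneseries_lim_ge => n _ _.
    by rewrite lee_fin ltW //; exact: (fpos n).2.
  have S0 : (0 <= S)%E by have := S_ge 0%N; rewrite big_geq.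
  case: S S_ge S0 S1 => [r| |] // S_ge S0; rewrite lte_fin => r1.
  have [p rp] := @ltr_add_invr R r 1 r1; exists p => m.
  have := S_ge m; rewrite lee_fin => /le_trans; apply.
  by rewrite lerBrDr ltW.
move=> [p fp]; split=> //; apply: (@le_lt_trans _ _ (1 - p.+1%:R^-1)%:E); last first.
  by rewrite lte_fin ltrBlDr ltrDl invr_gt0.
apply: lime_le.
  by apply: is_cvg_nneseries => n _ _; rewrite lee_fin ltW //; exact: (fpos n).2.
by near=> m; rewrite sumEFin lee_fin.
Unshelve. all: by end_near. Qed.

Lemma deficient_set_shift x : Y (T x) <-> Y x.
Proof.
have cv i : cvgn (@visit_average R X T (A i) (T x)) <->
            cvgn (@visit_average R X T (A i) x).
  by split=> /cvg_ex[l c]; apply/cvg_ex; exists l; apply/visit_average_cvg_shift.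
split=> /deficient_setP[c [p fp]]; apply/deficient_setP.
  have c' i : cvgn (@visit_average R X T (A i) x) by exact: (cv i).1 (c i).1.
  split.
    by move=> i; split=> //; rewrite -(freq_shift (c' i)); exact: (c i).2.
  exists p => m; under eq_bigr do rewrite -(freq_shift (c' _)); exact: fp.
split.
  by move=> i; split; [exact: (cv i).2 (c i).1|rewrite (freq_shift (c i).1); exact: (c i).2].
exists p => m; under eq_bigr do rewrite (freq_shift (c _).1); exact: fp.
Qed.

Lemma deficient_freq_shift x i : Y x -> freq (T x) i = freq x i.
Proof. by move=> /deficient_setP[c _]; apply: freq_shift; have [] := c i. Qed.

(** A strict inequality between limits holds for the averages from some time on; multiplied by [n],
    it becomes one between integers. *)
Lemma deficient_eventually x a b (c e e' : nat) : Y x ->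
  c%:R * (\sum_(a <= i < b) freq x i) + e'%:R < e%:R ->
  exists N, forall n, (N <= n)%N ->
    (c * (\sum_(a <= i < b) visits T (A i) n x) + e' * n <= e * n)%N.
Proof.
move=> /deficient_setP[cv _] lt.
have avg_cvg : (c%:R * (\sum_(a <= i < b) visit_average R T (A i) x n) + e'%:R)
    @[n --> \oo] --> c%:R * (\sum_(a <= i < b) freq x i) + e'%:R.
  apply: cvgD; last exact: cvg_cst.
  apply: cvgM; first exact: cvg_cst.
  elim: (index_iota a b) => [|i r IH].
    by rewrite big_nil; under eq_fun do rewrite big_nil; exact: cvg_cst.
  by rewrite big_cons; under eq_fun do rewrite big_cons; apply: cvgD; first exact: (cv i).1.
have [N _ hN] : \forall n \near \oo,
    c%:R * (\sum_(a <= i < b) visit_average R T (A i) x n) + e'%:R < e%:R.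
  exact: cvgr_lt avg_cvg _ lt.
exists N.+1 => n Nn.
have n0 : (0 : R) < n%:R by rewrite ltr0n; lia.
have {}hN := hN n (ltnW Nn).
have avgE : \sum_(a <= i < b) visit_average R T (A i) x n =
    n%:R^-1 * (\sum_(a <= i < b) visits T (A i) n x)%:R.
  by rewrite natr_sum mulr_sumr; apply: eq_bigr => i _; rewrite visit_averageE.
move: hN => /ltW; rewrite /= avgE -(ler_pM2r n0) mulrDl -!mulrA.
by rewrite [n%:R^-1 * _]mulrCA mulVf ?gt_eqF// mulr1 -!natrM -natrD ler_nat.
Qed.

End Frequency.

(** The Cauchy criterion with integer quantifiers, from which the convergence set is seen to be
    measurable. *)
Lemma real_cvgnP (R : realType) (u : nat -> R) : cvgn u <->
  forall p, exists N, forall n, (N <= n)%N -> (`|u N - u n| <= p.+1%:R^-1)%R.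
Proof.
split=> [/cvg_ex[l ul] p|h].
  have e0 : (0 < p.+1%:R^-1 / 2 :> R)%R by rewrite divr_gt0.
  have /cvgrPdist_le/(_ _ e0)[N _ hN] := ul.
  exists N => n Nn; rewrite -(subrKA l) [leRHS]splitr.
  apply: le_trans (ler_normD _ _) (lerD _ (hN n Nn)).
  by rewrite distrC; apply: hN => /=.
apply/cauchy_cvgP/cauchy_exP => e e0.
have [p] := @ltr_add_invr R 0%R e e0; rewrite add0r => pe.
have [N hN] := h p; exists (u N); exists N => // n /hN un.
by apply: le_lt_trans pe.
Qed.

(** * Measurable invariant choice of the stage and of the index blocks *)

Section Indices.
Variables (R : realType) (d : measure_display) (X : measurableType d).
Variables (T U : X -> X) (A : nat -> set X).
Hypotheses (TK : cancel T U) (UK : cancel U T).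
Hypothesis mT : forall E, measurable E -> measurable [set x | E (T x)].
Hypothesis mU : forall E, measurable E -> measurable [set x | E (U x)].
Hypothesis mA : forall i, measurable (A i).
Hypothesis coverA : forall x, exists i, A i x.
Local Notation Y := (deficient_set R T A).
Local Notation freq x i := (visit_frequency R T x (A i)).

Local Open Scope ring_scope.

Let sM : sigma_algebra [set: X] measurable := @sigma_algebra_measurable d X.

Lemma cvgn_visit_measurable i :
  measurable [set x | cvgn (@visit_average R X T (A i) x)].
Proof.
apply: (@sigma_ext _ _ (fun x => forall p, exists N, forall n, (N <= n)%N ->
   `|visit_average R T (A i) x N - visit_average R T (A i) x n| <= p.+1%:R^-1)).
  by move=> x; apply: iff_sym; exact: real_cvgnP.
apply: (sigma_forall sM) => p; apply: (sigma_exists sM) => N.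
apply: (sigma_forall sM) => n; apply: (sigma_imp sM); first exact: (sigma_cst sM).
have := visits_sigma2 sM mT (fun a b =>
  `|N%:R^-1 * a%:R - n%:R^-1 * b%:R| <= p.+1%:R^-1 :> R) N n (mA i) (mA i).
by apply: sigma_ext => x; rewrite !visit_averageE.
Qed.

Lemma freq_measurable (D : set X) i : measurable D ->
  (forall x, D x -> cvgn (@visit_average R X T (A i) x)) ->
  measurable_fun D (fun x => freq x i).
Proof.
move=> mD cD; apply: (measurable_fun_cvg (h := fun n x => visit_average R T (A i) x n)).
  move=> n; apply: measurable_funM; first exact: measurable_cst.
  apply: measurable_sum => j.
  rewrite (_ : (fun x => _) = \1_[set x | A i (iter j T x)]).
    by apply: measurable_indic; exact: (sigma_iter mT j (mA i)).
  by apply/funext => x; rewrite !indicE; congr (nat_of_bool _)%:R;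
    apply/idP/idP; rewrite !inE.
exact: cD.
Qed.

Lemma freq_sum_measurable (D : set X) a b (c e r : R) : measurable D ->
  (forall x i, D x -> cvgn (@visit_average R X T (A i) x)) ->
  measurable [set x | D x /\ c * (\sum_(a <= i < b) freq x i) + e <= r].
Proof.
move=> mD cD.
have mf : measurable_fun D (fun x => c * (\sum_(a <= i < b) freq x i) + e).
  apply: measurable_funD; last exact: measurable_cst.
  apply: measurable_funM; first exact: measurable_cst.
  by apply: measurable_sum => i; apply: freq_measurable => // x; exact: cD.
exact: (mf mD `]-oo, r]%classic (measurable_itv _)).
Qed.

Lemma deficient_set_measurable : measurable Y.
Proof.
pose D := [set x | forall i, cvgn (@visit_average R X T (A i) x)].
have mD : measurable D by apply: (sigma_forall sM); exact: cvgn_visit_measurable.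
(* The one-term sums, the factor 1 and the term 0 fit the shape of [freq_sum_measurable]. *)
apply: (@sigma_ext _ _ (fun x =>
  (forall i, D x /\ ~ (D x /\ 1 * (\sum_(i <= i < i.+1) freq x i) + 0 <= 0)) /\
  exists p : nat, forall m,
    D x /\ 1 * (\sum_(0 <= i < m) freq x i) + 0 <= 1 - p.+1%:R^-1)).
  move=> x; split=> [[fpos [p fp]]|/deficient_setP[fpos [p fp]]];
    [apply/deficient_setP; split|split].
  - move=> i; have [Dx nD] := fpos i; split; first exact: Dx.
    rewrite ltNge; apply/negP => f0; apply: nD; split=> //.
    by rewrite big_nat1 mul1r addr0.
  - by exists p => m; have [_] := fp m; rewrite mul1r addr0.
  - move=> i; split; first by move=> j; have [] := fpos j.
    rewrite big_nat1 mul1r addr0 => -[_]; rewrite leNgt.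
    by have [_ ->] := fpos i.
  - exists p => m; split; first by move=> j; have [] := fpos j.
    by rewrite mul1r addr0.
have fm := fun a b c e r => @freq_sum_measurable D a b c e r mD (fun x i Dx => Dx i).
by repeat (exact: mD || exact: fm || sigma_step sM).
Qed.

Let Ycvg x i : Y x -> cvgn (@visit_average R X T (A i) x).
Proof. by move=> /deficient_setP[c _]; have [] := c i. Qed.

Let freq_sum_ge0 x a b : Y x -> 0 <= \sum_(a <= i < b) freq x i.
Proof.
by move=> /deficient_setP[c _]; apply: sumr_ge0 => i _; apply: ltW; have [] := c i.
Qed.

(** The first [j] at which the total frequency is at most [1 - 3 / sepbound j]; the 3 leaves a
    strict margin over the 2 of [frequent_visits]. *)
Definition stage0 (x : X) : nat := least (fun j => Y x /\ forall m,
  (sepbound j)%:R * (\sum_(0 <= i < m) freq x i) + 3%:R <= (sepbound j)%:R :> R).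

(** Summing makes the constant increase with [j], whence [cutoff_mono], while still dominating
    [rarity j]. *)
Definition weight (j : nat) : nat := (\sum_(l < j.+1) rarity l)%N.

(** Beyond the cutoff the frequencies add up to at most [1 / (2 * weight j)]; [j <= m] makes the
    cutoffs unbounded. *)
Definition cutoff (j : nat) (x : X) : nat := least (fun m => Y x /\ (j <= m)%N /\
  forall m', (weight j)%:R * (\sum_(m <= i < m') freq x i) + 0 <= 2^-1 :> R).

Lemma stage0_spec x : Y x -> forall m,
  (sepbound (stage0 x))%:R * (\sum_(0 <= i < m) freq x i) + 3%:R
    <= (sepbound (stage0 x))%:R :> R.
Proof.
move=> Yx; suff : exists j, Y x /\ forall m,
  (sepbound j)%:R * (\sum_(0 <= i < m) freq x i) + 3%:R <= (sepbound j)%:R :> R.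
  by move=> /least_spec[[]].
have /deficient_setP[_ [p fp]] := Yx.
(* As [sepbound j >= j], this choice gives [3 / sepbound j <= 1 / (p+1)]. *)
exists (3 * p.+1)%N; split=> // m; set g := sepbound _.
have gp : (3 * p.+1 <= g)%N by rewrite /g mulnS /=; lia.
have gp' : 3%:R <= g%:R * p.+1%:R^-1 :> R.
  by rewrite ler_pdivlMr// -natrM ler_nat.
apply: (@le_trans _ _ (g%:R * (1 - p.+1%:R^-1) + 3%:R)).
  by rewrite lerD2r ler_wpM2l.
by rewrite mulrBr mulr1 -lerBrDr lerD2l lerN2.
Qed.

(** The partial sums are bounded and increasing, so from some [m0] on they are within
    [1 / (2 * (c+1))] of their supremum. *)
Lemma tail_small x c : Y x -> exists m0, forall m m', (m0 <= m)%N ->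
  c%:R * (\sum_(m <= i < m') freq x i) + 0 <= 2^-1 :> R.
Proof.
move=> Yx; have /deficient_setP[_ [p fp]] := Yx.
pose u m := \sum_(0 <= i < m) freq x i; pose E := range u.
have supE : has_sup E.
  split; first by exists (u 0%N); exists 0%N.
  by exists (1 - p.+1%:R^-1) => _ [m _ <-]; exact: fp.
have e0 : 0 < 2^-1 / c.+1%:R :> R by rewrite divr_gt0 ?invr_gt0.
have [_ [m0 _ <-] um0] := sup_adherent e0 supE.
exists m0 => m m' m0m; rewrite addr0.
case: (leqP m' m) => mm'; first by rewrite big_geq// mulr0 invr_ge0.
have um' : u m' <= sup E by apply: sup_upper_bound => //; exists m'.
have umE a b : (a <= b)%N -> u b = u a + \sum_(a <= i < b) freq x i.
  by move=> ab; rewrite /u (@big_cat_nat _ _ _ a).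
have tail : \sum_(m <= i < m') freq x i <= 2^-1 / c.+1%:R.
  have h1 := umE m m' (ltnW mm'); have h2 := umE m0 m m0m.
  have h3 := freq_sum_ge0 m0 m Yx.
  move: um' um0 h3; rewrite h1 h2; move: (sup E) (2^-1 / _) => S e.
  move: (\sum_(m <= i < m') _) (\sum_(m0 <= i < m) _) (u m0) => a b v; lra.
apply: (@le_trans _ _ (c.+1%:R * (2^-1 / c.+1%:R))).
  by apply: ler_pM => //; [exact: freq_sum_ge0|rewrite ler_nat].
by rewrite mulrCA divff ?mulr1 ?pnatr_eq0.
Qed.

Lemma cutoff_spec j x : Y x -> (j <= cutoff j x)%N /\ forall m',
  (weight j)%:R * (\sum_(cutoff j x <= i < m') freq x i) + 0 <= 2^-1 :> R.
Proof.
move=> Yx; suff : exists m, Y x /\ (j <= m)%N /\ forall m',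
    (weight j)%:R * (\sum_(m <= i < m') freq x i) + 0 <= 2^-1 :> R.
  by move=> /least_spec[[_]].
have [m0 hm0] := tail_small (weight j) Yx.
exists (maxn j m0); split=> //; split; first exact: leq_maxl.
by move=> m'; apply: hm0; exact: leq_maxr.
Qed.

Lemma cutoff_mono i j x : Y x -> (i <= j)%N -> (cutoff i x <= cutoff j x)%N.
Proof.
move=> Yx ij; apply: least_mono.
  by exists (cutoff j x); split=> //; exact: cutoff_spec.
move=> m [_ [jm hm]]; split=> //; split; first exact: leq_trans jm.
move=> m'; apply: le_trans (hm m'); rewrite lerD2r ler_wpM2r ?freq_sum_ge0 //.
rewrite ler_nat /weight -!(big_mkord xpredT rarity).
by rewrite [leqRHS](@big_cat_nat _ _ _ i.+1) ?leq_addr.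
Qed.

Lemma least_shift_freq x (Q : (nat -> R) -> nat -> Prop) :
  least (fun n => Y (T x) /\ Q (fun i => freq (T x) i) n) =
  least (fun n => Y x /\ Q (fun i => freq x i) n).
Proof.
congr least; apply/funext => n; apply/propext; rewrite deficient_set_shift.
case: (pselect (Y x)) => Yx; last by split=> -[].
suff -> : (fun i => freq (T x) i) = (fun i => freq x i) by [].
by apply/funext => i; exact: deficient_freq_shift.
Qed.

Lemma stage0_shift x : stage0 (T x) = stage0 x.
Proof.
exact: (least_shift_freq x (fun s j => forall m,
  (sepbound j)%:R * (\sum_(0 <= i < m) s i) + 3%:R <= (sepbound j)%:R)).
Qed.

Lemma cutoff_shift j x : cutoff j (T x) = cutoff j x.
Proof.
exact: (least_shift_freq x (fun s m => (j <= m)%N /\ forall m',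
  (weight j)%:R * (\sum_(m <= i < m') s i) + 0 <= 2^-1)).
Qed.

Let freq_sum_in a b (c e r : R) :
  measurable [set x | Y x /\ c * (\sum_(a <= i < b) freq x i) + e <= r].
Proof. by apply: freq_sum_measurable; [exact: deficient_set_measurable|exact: Ycvg]. Qed.

Lemma stage0_measurable n : measurable [set x | stage0 x = n].
Proof.
apply: (least_sigma n sM) => j.
apply: (@sigma_ext _ _ (fun x => forall m, Y x /\
  (sepbound j)%:R * (\sum_(0 <= i < m) freq x i) + 3%:R <= (sepbound j)%:R :> R)).
  move=> x; split=> [h|[Yx h] m]; last by split.
  by split=> [|m]; [have [] := h 0%N|have [] := h m].
by repeat (exact: freq_sum_in || sigma_step sM).
Qed.

Lemma cutoff_measurable j n : measurable [set x | cutoff j x = n].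
Proof.
apply: (least_sigma n sM) => m.
apply: (@sigma_ext _ _ (fun x => (j <= m)%N /\ forall m', Y x /\
  (weight j)%:R * (\sum_(m <= i < m') freq x i) + 0 <= 2^-1 :> R)).
  move=> x; split=> [[jm h]|[Yx [jm h]]]; last by split.
  by split; [have [] := h 0%N|split=> // m'; have [] := h m'].
by repeat (exact: freq_sum_in || sigma_step sM).
Qed.

(** The cutoff depends on [x] but is constant along orbits in [Y], so on each orbit only finitely
    many cells occur here. *)
Definition frequent : set X :=
  [set x | exists i, A i x /\ (i < cutoff (stage0 x).+1 x)%N].

Definition rare (j : nat) : set X :=
  [set x | exists i, A i x /\ (cutoff j x <= i < cutoff j.+1 x)%N].

Lemma rare_measurable j : measurable (rare j).
Proof.
apply: (@sigma_ext _ _ (fun x => exists i, A i x /\ exists a, (a <= i)%N /\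
  cutoff j x = a /\ exists b, (i < b)%N /\ cutoff j.+1 x = b)).
  move=> x; split=> [[i [Ai [a [ai [ca [b [ib cb]]]]]]]|[i [Ai /andP[ai ib]]]].
    by exists i; rewrite ca cb ai ib.
  by exists i; split=> //; exists (cutoff j x); split=> //; split=> //; exists (cutoff j.+1 x).
by repeat (exact: mA || exact: cutoff_measurable || sigma_step sM).
Qed.

Lemma rare_cover x : Y x ->
  frequent x \/ exists2 j, (stage0 x < j)%N & rare j x.
Proof.
move=> Yx; have [i Ai] := coverA x.
case: (ltnP i (cutoff (stage0 x).+1 x)) => [ic|ci]; first by left; exists i.
have ex : exists j, (i < cutoff j x)%N.
  by exists i.+1; have [] := cutoff_spec i.+1 Yx.
case: (ex_minnP ex) => j ij jmin; right.
(* [j] is the first cutoff beyond [i], so [i] belongs to block [j.-1], whose index must exceed the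
   stage. *)
have kj : ((stage0 x).+1 < j)%N.
  by rewrite ltnNge; apply/negP => /(cutoff_mono Yx); lia.
exists j.-1; first by lia.
exists i; split=> //; rewrite prednK; last by lia.
by rewrite ij andbT leqNgt; apply/negP => /jmin; lia.
Qed.

Lemma frequent_visits x : Y x -> exists N, forall n, (N <= n)%N ->
  (sepbound (stage0 x) * visits T frequent n x + 2 * n <= sepbound (stage0 x) * n)%N.
Proof.
move=> Yx; have spec := stage0_spec Yx (cutoff (stage0 x).+1 x).
have lt : (sepbound (stage0 x))%:R *
    (\sum_(0 <= i < cutoff (stage0 x).+1 x) freq x i) + 2%:R
    < (sepbound (stage0 x))%:R :> R by lra.
have [N hN] := deficient_eventually Yx lt; exists N => n /hN.
apply: leq_trans; rewrite leq_add2r leq_mul2l; apply/orP; right.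
apply: visits_cover => i [l [Al]].
by rewrite (iter_k stage0_shift) (iter_k (cutoff_shift _)) => lc; exists l.
Qed.

Lemma rare_visits x j : Y x -> (stage0 x < j)%N ->
  exists N, forall n, (N <= n)%N -> (rarity j * visits T (rare j) n x <= n)%N.
Proof.
move=> Yx _; have [_ /(_ (cutoff j.+1 x)) spec] := cutoff_spec j Yx.
have lt : (rarity j)%:R * (\sum_(cutoff j x <= i < cutoff j.+1 x) freq x i) + 0%:R
    < 1%:R :> R.
  apply: (@le_lt_trans _ _ 2^-1); last by lra.
  apply: le_trans spec; rewrite lerD2r ler_wpM2r ?freq_sum_ge0 //.
  by rewrite ler_nat /weight big_ord_recr leq_addl.
have [N hN] := deficient_eventually Yx lt; exists N => n /hN.
rewrite mul0n addn0 mul1n; apply: leq_trans; rewrite leq_mul2l; apply/orP; right.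
apply: visits_cover => i [l [Al]].
by rewrite !(iter_k (cutoff_shift _)) => lc; exists l.
Qed.

(** A periodic orbit meets finitely many cells, which take up all its visits, whereas their
    frequencies add up to less than 1. *)
Lemma deficient_aperiodic x p : Y x -> (0 < p)%N -> iter p T x <> x.
Proof.
move=> Yx p0 px.
have [m hm] : exists m, forall i, (i < p)%N -> exists2 l, (l < m)%N & A l (iter i T x).
  elim: p {p0 px} => [|p [m hm]]; first by exists 0%N.
  have [l Al] := coverA (iter p T x); exists (maxn m l.+1) => i.
  rewrite ltnS leq_eqVlt => /predU1P[->|/hm[l' lm Al']]; first by exists l => //; lia.
  by exists l' => //; lia.
have perq q : iter (q * p) T x = x by elim: q => // q IH; rewrite mulSn iterD IH.
have spec := stage0_spec Yx m.
have lt : (sepbound (stage0 x))%:R * (\sum_(0 <= i < m) freq x i) + 2%:R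
    < (sepbound (stage0 x))%:R :> R by lra.
have [N hN] := deficient_eventually Yx lt.
have : (visits T setT N.+1 x <= \sum_(0 <= i < m) visits T (A i) N.+1 x)%N.
  apply: visits_cover => i _; have [] := hm (i %% p)%N; first by rewrite ltn_mod.
  move=> l lm Al; exists l; split=> //.
  by rewrite (divn_eq i p) addnC iterD perq.
have -> : visits T setT N.+1 x = N.+1.
  by elim: N.+1 => // n IH; rewrite visitsS IH asboolT // addn1.
by have := hN N.+1 (leqnSn N); nia.
Qed.

End Indices.

(** * Assembly of the generator on the deficient set *)

Theorem theorem7p7 (R : realType) (d : measure_display) (X : measurableType d)
    (T : X -> X) (A : nat -> set X)
    (sysT : borel_system R T)
    (partA : measurable_partition A [set: X]) :
  [/\ measurable (deficient_set R T A),
      T @^-1` deficient_set R T A = deficient_set R T A &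
      exists B : 'I_16 -> set X, set_generator T (deficient_set R T A) B].
Proof.
have [/standard_borel_base[C [mC genC sepC]] [[U TK UK] mT0 mT1]] := sysT.
have [mA _ coverA0] := partA.
have mT E : measurable E -> measurable [set x | E (T x)].
  by move=> mE; have := mT0 measurableT _ mE; rewrite setTI.
have mU E : measurable E -> measurable [set x | E (U x)].
  move=> /mT1; congr measurable; apply/seteqP; split => x /=.
    by move=> [y Ey <-]; rewrite TK.
  by move=> EU; exists (U x); rewrite ?UK.
have coverA x : exists i, A i x.
  by have : setT x by []; rewrite -coverA0 => -[i _ Ai]; exists i.
set Y := deficient_set R T A.
have mY : measurable Y by exact: deficient_set_measurable.
have YT x : Y (T x) <-> Y x by exact: deficient_set_shift.
split; [exact: mY|by apply/seteqP; split=> x; [exact: (YT x).1|exact: (YT x).2]|].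
have YT1 x : Y x -> Y (T x) := (YT x).2.
have YU x : Y x -> Y (U x) by move=> Yx; apply: (YT _).1; rewrite UK.
have CY x N : Y x -> exists k, C k x /\ forall j, (0 < j < N)%N -> ~ C k (iter j T x).
  (* By aperiodicity the iterates of positive order differ from [x], so a base set separates [x]
     from them. *)
  move=> Yx; have [j jN|k [Ckx Ck]] := sepC x N (fun j => iter j.+1 T x).
    exact: (deficient_aperiodic coverA Yx).
  by exists k; split=> // -[|j] // jN; apply: Ck; lia.
have kT := @stage0_shift R d X T A.
have cov := @rare_cover R d X T A coverA.
have Wf := @frequent_visits R d X T A.
have Vf := @rare_visits R d X T A.
have sM := @sigma_algebra_measurable d X.
pose V := rare R T A; pose k := stage0 R T A.
have mV j : measurable (V j) by exact: rare_measurable.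
have mk j : measurable [set x | k x = j] by exact: stage0_measurable.
apply: (atom4_generator TK UK YT mT mU mY
  (S0 := successors T U C) (S1 := active T U C V) (S2 := reserve T U C k)
  (S3 := tape T U C Y k V)).
- exact: successors_sigma.
- exact: active_sigma.
- exact: reserve_sigma.
- exact: (tape_sigma TK UK YT1 YU CY kT cov Wf Vf).
move=> G sG GT GY GS GA GZ GB E mE.
(* The sets whose trace on [Y] lies in [G] form a sigma-algebra containing the base, hence every
   measurable set. *)
pose G' := [set E | G [set x | Y x /\ E x]].
suff : G' E by [].
apply: genC mE; last by move=> n; exact: (base_in TK UK YT1 YU CY kT cov Wf Vf sG GT).
split.
- by apply: (sigma_and sG) => //; exact: (sigma_cst sG False).
- move=> F GF; rewrite /G' /=; apply: (@sigma_ext _ _ (fun x => Y x /\ ~ (Y x /\ F x))).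
    by move=> x; split=> [[Yx nF]|[Yx [_ nF]]]; split=> //; [split=> // Fx; apply: nF|case].
  by repeat sigma_step sG.
- move=> F GF; rewrite /G' /=; apply: (@sigma_ext _ _ (fun x => exists n, Y x /\ F n x)).
    by move=> x; split=> [[n [Yx Fx]]|[Yx [n _ Fx]]]; [split=> //|]; exists n.
  by apply: (sigma_exists sG) => n; exact: GF.
Qed.
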